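(* Let $(M,g)$ be a complete Riemannian manifold, $x_0\in M$, $r$ the distance from $x_0$, $\xi:E\to M$ a Riemannian vector bundle, and $F:[0,\infty)\to[0,\infty)$ a strictly increasing $C^2$ function with $F(0)=0$. Let $\omega\in A^p(\xi)$ have slowly divergent $\mathcal E_{F,g}$-energy, that is, $$\lim_{\rho\to\infty}\int_{B_\rho(x_0)}\frac{F(\frac{|\omega|^2}{2})}{\psi(r(x))}\,dv<\infty$$ for some continuous function $\psi(r)>0$ satisfying $$\int_{\rho_0}^\infty\frac{dr}{r\psi(r)}=+\infty\quad\text{for some }\rho_0>0 .$$ Then (i) for any $\lambda>0$, $\lim_{r\to\infty}\frac{\psi(r)}{r^\lambda}\ne\infty$ (i.e. $\psi(r)/r^\lambda$ does not tend to $\infty$ as $r\to\infty$); (ii) if $\lim_{r\to\infty}\frac{\psi(r)}{r^\lambda}$ exists for some $\lambda>0$, then $$\int_{B_\rho(x_0)}F\Big(\frac{|\omega|^2}{2}\Big)dv=o(\rho^\lambda)\quad\text{as }\rho\to\infty .$$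
   Context: $A^p(\xi)=\Gamma(\Lambda^pT^*M\otimes E)$ is the space of smooth $p$-forms with values in $E$, with $|\omega|^2=\sum_{i_1<\cdots<i_p}|\omega(e_{i_1},\dots,e_{i_p})|_E^2$ for a local orthonormal frame $\{e_i\}$, where $E$ carries a smooth fiber metric. $B_\rho(x_0)$ is the geodesic ball of radius $\rho$ centered at $x_0$. $\psi$ is a positive continuous function of $r\in(0,\infty)$. *)

(* Defs.v *)
From HB Require Import structures.
From mathcomp Require Import all_boot all_order all_algebra.
From mathcomp Require Import all_classical all_reals all_analysis.

Set Implicit Arguments.
Unset Strict Implicit.
Unset Printing Implicit Defensive.

Import Order.TTheory GRing.Theory Num.Theory.
Import numFieldNormedType.Exports.

Local Open Scope classical_set_scope.
Local Open Scope ring_scope.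

(* Only meaningful for open [U]: the values of ['D_v f] outside [U] are
   irrelevant there. *)

Fixpoint Ck_on (R : realType) (n : nat) (V : normedModType R) (k : nat)
    (U : set 'rV[R]_n) (f : 'rV[R]_n -> V) : Prop :=
  (forall y, U y -> {for y, continuous f}) /\
  if k is k'.+1 then
    forall s : 'I_n,
      (forall y, U y -> derivable f y (delta_mx 0 s)) /\
      Ck_on k' U ('D_(delta_mx 0 s) f)
  else True.

Definition smooth_on (R : realType) (n : nat) (V : normedModType R)
    (U : set 'rV[R]_n) (f : 'rV[R]_n -> V) : Prop :=
  forall k, Ck_on k U f.

(* [phi i] and [phi_inv i] are total functions, relevant only on [dom i] and
   on [phi i @` dom i]. *)

Record smooth_manifold (R : realType) (n : nat) (M : topologicalType) := {
  chart : Type;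
  dom : chart -> set M;
  phi : chart -> M -> 'rV[R]_n;
  phi_inv : chart -> 'rV[R]_n -> M;
  manifold_hausdorff : hausdorff_space M;
  manifold_second_countable : @second_countable M;
  dom_cover : forall x, exists i, dom i x;
  dom_open : forall i, open (dom i);
  codom_open : forall i, open (phi i @` dom i);
  phiK : forall i x, dom i x -> phi_inv i (phi i x) = x;
  phi_continuous : forall i x, dom i x -> {for x, continuous (phi i)};
  phi_inv_continuous : forall i y,
    (phi i @` dom i) y -> {for y, continuous (phi_inv i)};
  transition_smooth : forall i j,
    smooth_on (phi i @` (dom i `&` dom j)) (phi j \o phi_inv i)
}.

(* The function [f] on M, expressed in the chart [i], is smooth on the part of
   the open set [A] covered by that chart. *)
Definition smooth_in_chart (R : realType) (n : nat) (M : topologicalType)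
    (S : smooth_manifold R n M) (V : normedModType R)
    (i : chart S) (A : set M) (f : M -> V) : Prop :=
  smooth_on (phi i @` (dom i `&` A)) (f \o phi_inv i).

(* Tangent vectors at x are given by their components (row vectors) in each
   chart around x; components in [i] are sent to components in [j] by right
   multiplication by this matrix. *)
Definition transition_jacobian (R : realType) (n : nat) (M : topologicalType)
    (S : smooth_manifold R n M) (i j : chart S) (x : M) : 'M[R]_n :=
  jacobian (phi j \o phi_inv i) (phi i x).

(* [gram i x] is the Gram matrix of g_x in the coordinate basis of the
   chart [i]. *)

Record riemannian_metric (R : realType) (n : nat) (M : topologicalType)
    (S : smooth_manifold R n M) := {
  gram : chart S -> M -> 'M[R]_n;
  gram_sym : forall i x, dom i x -> (gram i x)^T = gram i x;
  gram_posdef : forall i x (u : 'rV[R]_n),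
    dom i x -> u != 0 -> 0 < (u *m gram i x *m u^T) 0 0;
  gram_transition : forall i j x, dom i x -> dom j x ->
    gram i x = transition_jacobian i j x *m gram j x
                 *m (transition_jacobian i j x)^T;
  gram_smooth : forall i s t,
    smooth_in_chart i setT (fun x => gram i x s t : R^o)
}.

(* A piecewise C^1 path is a finite concatenation of C^1 arcs [0,1] -> M, each
   contained in the domain of a chart.  An arc that is C^1 on [0,1] up to the
   end points is the restriction of a C^1 map on R, so arcs are given by such
   maps. *)

Definition C1_curve (R : realType) (n : nat) (c : R -> 'rV[R]_n) : Prop :=
  (forall t, derivable c t 1) /\ continuous (derive1 c).

Definition speed (R : realType) (n : nat) (M : topologicalType)
    (S : smooth_manifold R n M) (g : riemannian_metric S)
    (i : chart S) (c : R -> 'rV[R]_n) (t : R) : R :=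
  Num.sqrt ((derive1 c t *m gram g i (phi_inv i (c t)) *m (derive1 c t)^T) 0 0).

(* [path_length g x y l]: some piecewise C^1 path from x to y has length l. *)
Inductive path_length (R : realType) (n : nat) (M : topologicalType)
    (S : smooth_manifold R n M) (g : riemannian_metric S) :
    M -> M -> \bar R -> Prop :=
| path_nil x : path_length g x x 0%E
| path_cons (i : chart S) (c : R -> 'rV[R]_n) y l :
    C1_curve c ->
    (forall t, 0 <= t <= 1 -> (phi i @` dom i) (c t)) ->
    path_length g (phi_inv i (c 1)) y l ->
    path_length g (phi_inv i (c 0)) y
      (\int[lebesgue_measure]_(t in `[0%R, 1%R]) (speed g i c t)%:E + l)%E.

(* Equal to +oo when x and y lie in different connected components. *)
Definition geodesic_dist (R : realType) (n : nat) (M : topologicalType)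
    (S : smooth_manifold R n M) (g : riemannian_metric S) (x y : M) : \bar R :=
  ereal_inf [set l | path_length g x y l].

Definition geodesic_ball (R : realType) (n : nat) (M : topologicalType)
    (S : smooth_manifold R n M) (g : riemannian_metric S)
    (x0 : M) (rho : R) : set M :=
  [set x | (geodesic_dist g x0 x < rho%:E)%E].

Definition complete_metric (R : realType) (n : nat) (M : topologicalType)
    (S : smooth_manifold R n M) (g : riemannian_metric S) : Prop :=
  forall u : nat -> M,
    (forall e : R, 0 < e -> exists N : nat, forall k l : nat,
      (N <= k)%N -> (N <= l)%N -> (geodesic_dist g (u k) (u l) < e%:E)%E) ->
    exists x, geodesic_dist g (u k) x @[k --> \oo] --> 0%E.

Notation borel T := (g_sigma_algebraType (@open T)).

(* Characterizes n-dimensional Lebesgue measure (on Borel sets). *)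
Definition is_lebesgue_measure (R : realType) (n : nat)
    (leb : {measure set (borel 'rV[R]_n) -> \bar R}) : Prop :=
  forall a b : 'rV[R]_n, (forall s, a 0 s <= b 0 s) ->
    leb [set y : 'rV[R]_n | forall s, a 0 s <= y 0 s <= b 0 s] =
      (\prod_(s < n) (b 0 s - a 0 s))%:E.

(* Characterizes the measure dv of g: in every chart, dv = sqrt (det g) dy. *)
Definition is_riemannian_volume (R : realType) (n : nat) (M : ptopologicalType)
    (S : smooth_manifold R n M) (g : riemannian_metric S)
    (dv : {measure set (borel M) -> \bar R}) : Prop :=
  exists2 leb : {measure set (borel 'rV[R]_n) -> \bar R},
    is_lebesgue_measure leb &
    forall (i : chart S) (A : set (borel M)), measurable A -> A `<=` dom i ->
      dv A = (\int[leb]_(y in phi i @` A)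
                (Num.sqrt (\det (gram g i (phi_inv i y))))%:E)%E.

(* The bundle given by its fibers and local trivializations; [triv a x] and
   [triv_inv a x] are relevant only for x in [triv_dom a]. *)

Record vector_bundle (R : realType) (n : nat) (M : topologicalType)
    (S : smooth_manifold R n M) (k : nat) := {
  fiber : M -> lmodType R;
  triv_index : Type;
  triv_dom : triv_index -> set M;
  triv : forall (a : triv_index) (x : M), {linear fiber x -> 'rV[R]_k};
  triv_inv : forall (a : triv_index) (x : M), 'rV[R]_k -> fiber x;
  triv_dom_open : forall a, open (triv_dom a);
  triv_dom_cover : forall x, exists a, triv_dom a x;
  trivK : forall a x, triv_dom a x -> cancel (triv a x) (triv_inv a x);
  triv_invK : forall a x, triv_dom a x -> cancel (triv_inv a x) (triv a x);
  triv_transition_smooth : forall a b (i : chart S) (s : 'I_k),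
    smooth_in_chart i (triv_dom a `&` triv_dom b)
      (fun x => triv b x (triv_inv a x (delta_mx 0 s)))
}.

Record fiber_metric (R : realType) (n : nat) (M : topologicalType)
    (S : smooth_manifold R n M) (k : nat) (E : vector_bundle S k) := {
  inner : forall x, fiber E x -> fiber E x -> R;
  inner_sym : forall x (u v : fiber E x), inner u v = inner v u;
  inner_linear : forall x (a : R) (u v w : fiber E x),
    inner (a *: u + v) w = a * inner u w + inner v w;
  inner_posdef : forall x (u : fiber E x), u != 0 -> 0 < inner u u;
  inner_smooth : forall (a : triv_index E) (i : chart S) (s t : 'I_k),
    smooth_in_chart i (triv_dom a)
      (fun x => inner (triv_inv a x (delta_mx 0 s))
                      (triv_inv a x (delta_mx 0 t)) : R^o)
}.

(* [form w i x v] is the value of the form at x on the p tangent vectors whose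
   components in the chart [i] are [v]. *)

Record bundle_form (R : realType) (n : nat) (M : topologicalType)
    (S : smooth_manifold R n M) (k : nat) (E : vector_bundle S k)
    (p : nat) := {
  form : chart S -> forall x, ('I_p -> 'rV[R]_n) -> fiber E x;
  form_multilinear : forall i x (v : 'I_p -> 'rV[R]_n) (l : 'I_p)
      (a : R) (u w : 'rV[R]_n), dom i x ->
    form i x [eta v with l |-> a *: u + w] =
      a *: form i x [eta v with l |-> u] + form i x [eta v with l |-> w];
  form_alternating : forall i x (v : 'I_p -> 'rV[R]_n) (l m : 'I_p),
    dom i x -> l != m -> v l = v m -> form i x v = 0;
  form_transition : forall i j x (v : 'I_p -> 'rV[R]_n),
    dom i x -> dom j x ->
    form i x v = form j x (fun l => v l *m transition_jacobian i j x);
  form_smooth : forall i (a : triv_index E) (I : 'I_p -> 'I_n),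
    smooth_in_chart i (triv_dom a)
      (fun x => triv a x (form i x (fun l => delta_mx 0 (I l))))
}.

Definition orthonormal_frame (R : realType) (n : nat) (M : topologicalType)
    (S : smooth_manifold R n M) (g : riemannian_metric S)
    (i : chart S) (x : M) (e : 'I_n -> 'rV[R]_n) : Prop :=
  forall s t, (e s *m gram g i x *m (e t)^T) 0 0 = (s == t)%:R.

Definition strictly_increasing (p n : nat) (I : {ffun 'I_p -> 'I_n}) : bool :=
  [forall l : 'I_p, forall m : 'I_p, (l < m)%N ==> (I l < I m)%N].

(* |w|^2 at x is the sum of |w(e_{i_1},...,e_{i_p})|^2 over i_1 < ... < i_p for
   any chart at x and any orthonormal frame (e_i) at x; the value does not
   depend on their choice, which [xget] makes. *)
Definition form_normsq (R : realType) (n : nat) (M : topologicalType)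
    (S : smooth_manifold R n M) (g : riemannian_metric S)
    (k : nat) (E : vector_bundle S k) (h : fiber_metric E)
    (p : nat) (w : bundle_form E p) (x : M) : R :=
  xget 0 [set c : R | exists (i : chart S) (e : 'I_n -> 'rV[R]_n),
    [/\ dom i x, orthonormal_frame g i x e &
        c = \sum_(I : {ffun 'I_p -> 'I_n} | strictly_increasing I)
              inner h (form w i x (e \o I)) (form w i x (e \o I))]].

(* The derivative at 0 is one-sided. *)
Definition has_derivative_nonneg (R : realType) (f f' : R -> R) : Prop :=
  forall t : R, 0 <= t ->
    (f s - f t) / (s - t) @[s --> within `[0, +oo[ (dnbhs t)] --> f' t.

Definition C2_nonneg (R : realType) (f : R -> R) : Prop :=
  exists f1 f2 : R -> R,
    [/\ has_derivative_nonneg f f1, has_derivative_nonneg f1 f2 &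
        {within `[0, +oo[, continuous f2}].

(* Makes [f =o_+oo g] available. *)
Canonical pinfty_filter_on (R : numFieldType) :=
  FilterType (pinfty_nbhs R) (@filter_filter _ _ proper_pinfty_nbhs).

(* Main.v *)
Require Import Defs.
From HB Require Import structures.
From mathcomp Require Import all_boot all_order all_algebra.
From mathcomp Require Import all_classical all_reals all_analysis.
From mathcomp Require Import perm ring lra.

Set Implicit Arguments.
Unset Strict Implicit.
Unset Printing Implicit Defensive.

Import Order.TTheory GRing.Theory Num.Theory.
Import numFieldNormedType.Exports.

Local Open Scope classical_set_scope.
Local Open Scope ring_scope.

(** Why the theorem holds.  Write [r] for the distance from [x0], [f] for
    [F (|w|^2 / 2)] and [Phi] for [f / psi r], so that the hypothesis bounds the
    integral of [Phi] over large balls.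

    (i) If [psi r / r^lambda] tended to infinity then [1 / (r psi r)] would be
    at most [r^(- lambda - 1)] for large [r], hence integrable at infinity,
    against the divergence hypothesis ([not_cvgy_div_powR]).

    (ii) By (i) a limit of [psi r / r^lambda] in the extended reals is not
    [+oo], so [psi r <= D r^lambda] for large [r].  The shell
    [B_rho minus B_r2] contributes to the energy at most
    [D rho^lambda] times the integral of [Phi] over that shell
    ([shell_integral_le]), and this integral is as small as desired once [r2] is
    large, since the integrals of [Phi] over shells are monotone and bounded
    ([shell_integral_small]).  The fixed ball [B_r2] has finite energy, which is
    negligible against [rho^lambda].  This is [energy_little_o].

    Everything thus rests on the finiteness of the energy of each ball
    ([energy_lty]).  Away from [x0] it follows from the hypothesis, because
    [psi] is bounded on compact subintervals of [(0, +oo)].  Near [x0] the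
    function [psi] may behave badly, and the energy is bounded directly: a
    small geodesic ball lies in any given neighbourhood of [x0]
    ([geodesic_ball_sub_nbhs]), and [x0] has a neighbourhood on which [|w|^2]
    is bounded ([form_normsq_bounded_near]) and one of finite volume
    ([volume_locally_finite]).

    For [geodesic_ball_sub_nbhs] take a bump function supported in a small
    coordinate ball around [x0].  In those coordinates the metric dominates a
    multiple of the Euclidean one, so along any arc, in whatever chart the arc is
    given, the derivative of the bump is at most a constant times the speed.  The
    bump is therefore Lipschitz for the geodesic distance, and points close to
    [x0] stay in its support.  Comparing charts requires the chain rule, hence the
    differentiability of transition maps, which are only known to have
    continuous partial derivatives ([differentiable_of_partials]).

    The integral of a nonnegative function is the supremum of the integrals of
    the simple functions below it, and this lower integral is monotone and, over
    disjoint measurable domains, additive for arbitrary functions.  Splitting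
    energies along geodesic balls is therefore legitimate as soon as these balls
    are measurable, and they are open ([open_geodesic_ball]). *)

(** * Lower integrals of arbitrary nonnegative functions *)

Section LowerIntegral.
Local Open Scope ereal_scope.
Context d (T : measurableType d) (R : realType) (mu : {measure set T -> \bar R}).
Implicit Types (f : T -> \bar R) (A B D : set T).
Import HBNNSimple.

Lemma ge0_integral_supE D f : (forall x, D x -> 0 <= f x) ->
  \int[mu]_(x in D) f x = ereal_sup [set sintegral mu h |
    h in [set h : {nnsfun T >-> R} | forall x, (h x)%:E <= (f \_ D) x]].
Proof. exact: ge0_integralE. Qed.

(** Every simple function below the first restricted integrand is below the
    second one. *)
Lemma ge0_integral_ler A B f f' : A `<=` B -> (forall x, A x -> 0 <= f x) ->
  (forall x, B x -> 0 <= f' x) -> (forall x, A x -> f x <= f' x) ->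
  \int[mu]_(x in A) f x <= \int[mu]_(x in B) f' x.
Proof.
move=> AB f0 f'0 ff'; rewrite !ge0_integral_supE//.
apply: ereal_sup_le => _ [h /= hf <-]; exists h => // x.
apply: le_trans (hf x) _; rewrite /patch.
have [/set_mem Ax|_] := boolP (x \in A); first by rewrite mem_set; [exact: ff'|exact: AB].
by case: ifPn => // /set_mem /f'0.
Qed.

(** The restrictions of a simple function to measurable sets [A] and [B] are
    simple, and their sum dominates it when it vanishes off the union. *)
Lemma ge0_integralU_le A B f : measurable A -> measurable B ->
  (forall x, (A `|` B) x -> 0 <= f x) ->
  \int[mu]_(x in A `|` B) f x <= \int[mu]_(x in A) f x + \int[mu]_(x in B) f x.
Proof.
move=> mA mB f0.
have fA0 x : A x -> 0 <= f x by move=> Ax; apply: f0; left.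
have fB0 x : B x -> 0 <= f x by move=> Bx; apply: f0; right.
rewrite [leLHS]ge0_integral_supE//; apply: ge_ereal_sup => _ [h /= hf <-].
pose hA := proj_nnsfun h mA; pose hB := proj_nnsfun h mB.
have hAE x : hA x = (if x \in A then h x else 0)%R.
  by have /(congr1 (@^~ x)) <- := mrestrict h mA.
have hBE x : hB x = (if x \in B then h x else 0)%R.
  by have /(congr1 (@^~ x)) <- := mrestrict h mB.
have hAB : sintegral mu h <= sintegral mu (add_nnsfun hA hB).
  apply: le_sintegral => x; rewrite [leRHS]/(hA x + hB x)%R hAE hBE.
  have := hf x; rewrite /patch in_setU.
  move=> hx; suff : (h x <= (if x \in A then h x else 0 : R) +
      (if x \in B then h x else 0 : R))%R by [].
  move: hx; case: (x \in A); case: (x \in B) => /= hx; rewrite ?addr0 ?add0r//.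
  by rewrite lerDl.
apply: le_trans hAB _; rewrite [leLHS]sintegralD.
apply: leeD; rewrite ge0_integral_supE//; apply: ereal_sup_ubound.
  exists hA => // x; rewrite hAE; have := hf x; rewrite /patch in_setU.
  by case: (x \in A); rewrite /= ?(mulr1, mulr0).
exists hB => // x; rewrite hBE; have := hf x; rewrite /patch in_setU.
by case: (x \in B); rewrite /= ?orbT ?(mulr1, mulr0).
Qed.

(** Simple functions below [f] on [A] and on [B] add up to one below [f] on the
    union, the two supports being disjoint.  To pass to both suprema, one
    integral at a time is moved to the other side; this is legitimate when the
    integral over the union is finite, and otherwise there is nothing to
    prove. *)
Lemma ge0_integralU_ge A B f : A `&` B = set0 ->
  (forall x, (A `|` B) x -> 0 <= f x) ->
  \int[mu]_(x in A) f x + \int[mu]_(x in B) f x <= \int[mu]_(x in A `|` B) f x.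
Proof.
move=> AB f0.
have fA0 x : A x -> 0 <= f x by move=> Ax; apply: f0; left.
have fB0 x : B x -> 0 <= f x by move=> Bx; apply: f0; right.
have [->|Ioo] := eqVneq (\int[mu]_(x in A `|` B) f x) +oo; first by rewrite leey.
have Ifin : \int[mu]_(x in A `|` B) f x \is a fin_num.
  by rewrite ge0_fin_numE ?integral_ge0// lt_neqAle Ioo leey.
have IA : \int[mu]_(x in A) f x \is a fin_num.
  rewrite ge0_fin_numE ?integral_ge0//; move: Ifin.
  rewrite ge0_fin_numE ?integral_ge0//; apply: le_lt_trans.
  by apply: ge0_integral_ler => // x; left.
rewrite -leeBrDl//.
rewrite [leLHS]ge0_integral_supE//; apply: ge_ereal_sup => _ [h2 /= h2f <-].
have h2I : sintegral mu h2 <= \int[mu]_(x in A `|` B) f x.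
  rewrite ge0_integral_supE//; apply: ereal_sup_ubound; exists h2 => // x.
  apply: le_trans (h2f x) _; rewrite /patch in_setU.
  case: (boolP (x \in B)); rewrite ?orbT// orbF => _.
  by case: ifPn => // /set_mem; exact: fA0.
have h2fin : sintegral mu h2 \is a fin_num.
  rewrite ge0_fin_numE ?sintegral_ge0//; apply: le_lt_trans h2I _.
  by rewrite lt_neqAle Ioo leey.
rewrite leeBrDl// addeC -leeBrDl//.
rewrite [leLHS]ge0_integral_supE//; apply: ge_ereal_sup => _ [h1 /= h1f <-].
rewrite leeBrDl// -sintegralD ge0_integral_supE//.
apply: ereal_sup_ubound; exists (add_nnsfun h2 h1) => // x.
rewrite [X in X%:E]/(h2 x + h1 x)%R.
have := h1f x; have := h2f x; rewrite /patch in_setU EFinD.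
have : ~ (x \in A /\ x \in B).
  by move=> [/set_mem Ax /set_mem Bx]; have : (A `&` B) x by []; rewrite AB.
case: (x \in A); case: (x \in B) => /= H; try by case: H.
- by move=> h20 h1x; rewrite -[leRHS]add0e leeD.
- by move=> h2x h10; rewrite -[leRHS]adde0 leeD.
- by move=> h20 h10; rewrite -[leRHS]adde0 leeD.
Qed.

(** Simple functions below [c f] are [c] times simple functions below [f]. *)
Lemma ge0_integral_scale_le D f (c : R) : (0 < c)%R ->
  (forall x, D x -> 0 <= f x) ->
  \int[mu]_(x in D) (c%:E * f x) <= c%:E * \int[mu]_(x in D) f x.
Proof.
move=> c0 f0; have cf0 x : D x -> 0 <= c%:E * f x.
  by move=> /f0 fx; rewrite mule_ge0// lee_fin ltW.
rewrite [leLHS]ge0_integral_supE//; apply: ge_ereal_sup => _ [h /= hf <-].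
have ci0 : (0 <= c^-1)%R by rewrite invr_ge0 ltW.
rewrite -lee_pdivrMl// -sintegralrM.
rewrite ge0_integral_supE//; apply: ereal_sup_ubound.
exists (scale_nnsfun h ci0) => // x.
rewrite [X in X%:E]/(c^-1 * h x)%R EFinM lee_pdivrMl//.
apply: le_trans (hf x) _; rewrite /patch; case: ifPn => //.
by rewrite mule0.
Qed.

Lemma ge0_integral_le_cst D A f (c : R) : D `<=` A -> measurable A -> (0 <= c)%R ->
  (forall x, D x -> 0 <= f x) -> (forall x, D x -> f x <= c%:E) ->
  \int[mu]_(x in D) f x <= c%:E * mu A.
Proof.
move=> DA mA c0 f0 fc; rewrite -integral_cst//.
by apply: ge0_integral_ler => // x _; rewrite lee_fin.
Qed.

End LowerIntegral.

(** * Growth of the weight *)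

Section Growth.
Context (R : realType).
Implicit Types (lambda a r : R).
Local Notation mu := (@lebesgue_measure R).

Lemma powR_cvgy lambda : 0 < lambda -> x `^ lambda @[x --> +oo] --> +oo.
Proof.
move=> l0; apply/cvgryPge => A; near=> x.
have m0 : 0 <= Num.max A 0 by rewrite le_max lexx orbT.
apply: (@le_trans _ _ (Num.max A 0)); first by rewrite le_max lexx.
rewrite -[leLHS]powRr1// -[X in _ `^ X <= _](mulVf (lt0r_neq0 l0)) powRrM.
apply: ge0_ler_powR; rewrite ?nnegrE ?powR_ge0 ?(ltW l0)//.
Unshelve. all: by end_near. Qed.

(** The antiderivative [- x^(- lambda) / lambda] vanishes at infinity. *)
Lemma integral_powR_lty lambda a : 0 < lambda -> 0 < a ->
  (\int[mu]_(x in `[a, +oo[) (x `^ (- lambda - 1))%:E < +oo)%E.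
Proof.
move=> l0 a0; pose f x := x `^ (- lambda - 1); pose G x := - lambda^-1 * x `^ (- lambda).
have fD (b x : R) : 0 < x -> derivable (fun y : R => y `^ b) x 1.
  by move=> x0; apply: derivable_powR; rewrite in_itv/= x0.
have GD (x : R) : 0 < x -> is_derive x 1 G (f x).
  move=> x0; have pD := is_derive1_powR (- lambda) x0.
  have -> : G = - lambda^-1 \*: (fun y : R => y `^ (- lambda)) by [].
  apply: is_derive_eq; rewrite [_ *: _]mulrA mulrNN mulVf ?mul1r//.
  exact: lt0r_neq0.
have Gl : G x @[x --> +oo] --> (0 : R).
  rewrite -[X in _ --> X](mulr0 (- lambda^-1)); apply: cvgM; first exact: cvg_cst.
  under eq_fun do rewrite powRN.
  apply/gtr0_cvgV0; last exact: powR_cvgy.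
  by near=> x; apply: powR_gt0; near: x; exact: nbhs_pinfty_gt.
suff -> : (\int[mu]_(x in `[a, +oo[) (f x)%:E = 0%:E - (G a)%:E)%E by rewrite ltry.
apply: ge0_continuous_FTC2y.
- by move=> x _; exact: powR_ge0.
- apply: derivable_within_continuous => x; rewrite in_itv/= andbT => ax.
  by apply: fD; exact: lt_le_trans ax.
- exact: Gl.
- by move=> x ax; have := GD x (lt_trans a0 ax) => ?; exact: ex_derive.
- apply: cvg_at_right_filter; apply/differentiable_continuous/derivable1_diffP.
  by have := GD a a0 => ?; exact: ex_derive.
- move=> x; rewrite in_itv/= andbT => ax; have := GD x (lt_trans a0 ax) => ?.
  by rewrite derive1E derive_val.
Unshelve. all: by end_near. Qed.

(** A weight with [psi r >= r^lambda] from some [r1] on would make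
    [1 / (r psi r)] integrable: continuity takes care of [[rho0, r1]], and
    comparison with [r^(- lambda - 1)] of the rest. *)
Lemma not_cvgy_div_powR (psi : R -> R) :
  (forall r : R, 0 < r -> 0 < psi r) ->
  (forall r : R, 0 < r -> {for r, continuous psi}) ->
  (exists2 rho0 : R, 0 < rho0 &
    (\int[mu]_(r in `[rho0, +oo[) ((r * psi r)^-1)%:E)%E = +oo%E) ->
  forall lambda : R, 0 < lambda -> ~ (psi r / r `^ lambda @[r --> +oo] --> +oo).
Proof.
move=> psi0 psiC [rho0 rho00 Ioo] lambda l0 /cvgryPge/(_ 1).
move=> [A [_ HA]].
pose r1 := Num.max rho0 (A + 1).
have r10 : 0 < r1 by rewrite lt_max rho00.
have psi_ge r : r1 <= r -> r `^ lambda <= psi r.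
  rewrite /r1 ge_max => /andP[rr Ar]; have r0 := lt_le_trans rho00 rr.
  by have := HA r; rewrite /= ler_pdivlMr ?powR_gt0// mul1r; apply; lra.
pose f r : \bar R := ((r * psi r)^-1)%:E.
have f0 r : 0 < r -> (0 <= f r)%E.
  by move=> r0; rewrite lee_fin invr_ge0 mulr_ge0 ?(ltW r0)// ltW// psi0.
have : (\int[mu]_(r in `[rho0, +oo[) f r <=
    \int[mu]_(r in `[rho0, r1]) f r + \int[mu]_(r in `[r1, +oo[) f r)%E.
  apply: le_trans (ge0_integralU_le _ _ _ _).
  - apply: ge0_integral_ler => //.
    + move=> r /=; rewrite !in_itv/= !andbT => rr.
      by have [rr1|rr1] := leP r r1; [left; rewrite rr|right; rewrite ltW].
    + by move=> r /=; rewrite in_itv/= andbT => rr; apply: f0; exact: lt_le_trans rr.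
    + move=> r [] /=; rewrite in_itv/= => /andP[rr _]; apply: f0;
        exact: lt_le_trans rr.
  - exact: measurable_itv.
  - exact: measurable_itv.
  - move=> r [] /=; rewrite in_itv/= => /andP[rr _]; apply: f0;
      exact: lt_le_trans rr.
rewrite [leLHS]Ioo leye_eq => /eqP.
have I1 : (\int[mu]_(r in `[rho0, r1]) f r \is a fin_num)%E.
  apply: integrable_fin_num => //.
  apply: continuous_compact_integrable; first exact: segment_compact.
  apply: continuous_in_subspaceT => r; rewrite inE/= in_itv/= => /andP[rr _].
  have r0 := lt_le_trans rho00 rr.
  apply: cvgV; first by rewrite mulf_neq0 ?gt_eqF// psi0.
  by apply: cvgM; [exact: cvg_id|exact: psiC].
have I2 : (\int[mu]_(r in `[r1, +oo[) f r < +oo)%E.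
  apply: le_lt_trans (integral_powR_lty l0 r10).
  apply: ge0_integral_ler => //.
  - by move=> r /=; rewrite in_itv/= andbT => rr; apply: f0; exact: lt_le_trans rr.
  - by move=> r _; rewrite lee_fin powR_ge0.
  - move=> r /=; rewrite in_itv/= andbT => rr; have r0 := lt_le_trans r10 rr.
    rewrite lee_fin -opprD powRN lef_pV2 ?posrE ?powR_gt0//; last first.
      by rewrite mulr_gt0// psi0.
    rewrite powRD; last by rewrite (gt_eqF r0) implybT.
    rewrite powRr1 ?(ltW r0)// mulrC ler_wpM2l ?(ltW r0)//.
    exact: psi_ge.
have : (\int[mu]_(r in `[rho0, r1]) f r + \int[mu]_(r in `[r1, +oo[) f r < +oo)%E.
  by rewrite lte_add_pinfty// ltey_eq I1.
by move=> /[swap] ->.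
Qed.

End Growth.

(** * Growth of the energy over balls *)

Section EnergyGrowth.
Context d (T : measurableType d) (R : realType) (mu : {measure set T -> \bar R}).
Variables (dist : T -> \bar R) (f : T -> R) (psi : R -> R).
Let B (rho : R) : set T := [set x | (dist x < rho%:E)%E].
Let Phi (x : T) : \bar R := (f x / psi (fine (dist x)))%:E.

Hypothesis dist_ge0 : forall x, (0 <= dist x)%E.
Hypothesis mB : forall rho, measurable (B rho).
Hypothesis f_ge0 : forall x, 0 <= f x.
Hypothesis psi_gt0 : forall r : R, 0 < r -> 0 < psi r.
Hypothesis psiC : forall r : R, 0 < r -> {for r, continuous psi}.
Variables (eps C : R).
Hypothesis C_ge0 : 0 <= C.
Hypothesis eps_gt0 : 0 < eps.
Hypothesis muB : (mu (B eps) < +oo)%E.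
Hypothesis fC : forall x, B eps x -> f x <= C.
Variable l : \bar R.
Hypothesis l_lty : (l < +oo)%E.
Hypothesis Phi_cvg : (\int[mu]_(x in B rho) Phi x)%E @[rho --> +oo] --> l.

Let N (rho : R) := B rho `\` B eps.

Lemma shellP r rho x : (B rho `\` B r) x -> r <= fine (dist x) < rho.
Proof.
move=> [xrho /negP]; rewrite /B/= -leNgt => rx.
have xfin : dist x \is a fin_num by rewrite ge0_fin_numE// (lt_trans xrho)// ltry.
by move: rx xrho; rewrite /B/= -(fineK xfin) lee_fin lte_fin => -> ->.
Qed.

Lemma shell_Phi_ge0 r rho x : 0 < r -> (B rho `\` B r) x -> (0 <= Phi x)%E.
Proof.
move=> r0 /shellP/andP[rx _]; rewrite lee_fin divr_ge0// ltW// psi_gt0//.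
exact: lt_le_trans rx.
Qed.

(** On a shell with positive inner radius, [f] is [psi] times [Phi]. *)
Lemma shell_integral_le r rho (D : R) : 0 < r -> 0 < D ->
  (forall t, r <= t < rho -> psi t <= D) ->
  (\int[mu]_(x in B rho `\` B r) (f x)%:E <=
    D%:E * \int[mu]_(x in B rho `\` B r) Phi x)%E.
Proof.
move=> r0 D0 psiD.
apply: le_trans (ge0_integral_scale_le _ D0 (fun x => shell_Phi_ge0 r0 (x := x))).
apply: ge0_integral_ler => // x Nx.
- by rewrite lee_fin.
- by rewrite mule_ge0 ?(shell_Phi_ge0 r0 Nx)// lee_fin ltW.
- have /andP[rx xrho] := shellP Nx; have p0 := psi_gt0 (lt_le_trans r0 rx).
  rewrite /Phi -EFinM lee_fin mulrA mulrC mulrA ler_peMl//.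
  by rewrite ler_pdivlMl// mulr1 psiD// rx.
Qed.

Let Q (rho : R) : \bar R := (\int[mu]_(x in N rho) Phi x)%E.

Lemma shell_integral_ge0 rho : (0 <= Q rho)%E.
Proof. by apply: integral_ge0 => x; exact: shell_Phi_ge0. Qed.

Lemma ball_mono r rho : r <= rho -> B r `<=` B rho.
Proof. by move=> rr x; rewrite /B/= => /lt_le_trans; apply; rewrite lee_fin. Qed.

(** The limit bounds the integrals of [Phi] over large balls from above, and
    what they miss of the integrals over the shells is at most the integral of
    the negative part of [Phi].  As [psi 0] may be negative this part need not
    vanish, but it lives where [dist] is zero: there [f] is at most [C], and the
    measure is finite. *)
Lemma shell_integrals_bounded : exists c : R, forall rho, (Q rho <= c%:E)%E.
Proof.
pose K := C / `|psi 0|; have K0 : 0 <= K by rewrite divr_ge0.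
pose N0 := (K%:E * mu (B eps))%E.
have N0fin : N0 \is a fin_num by rewrite fin_numM// ge0_fin_numE.
have [c cI] : exists c : R, \forall rho \near +oo,
    (\int[mu]_(x in B rho) Phi x < c%:E)%E.
  have [c lc] : exists c : R, (l < c%:E)%E.
    case: l l_lty => [r _|//|_]; last by exists 0; rewrite ltNyr.
    by exists (r + 1); rewrite lte_fin ltrDl.
  by exists c; exact: (Phi_cvg (open_ereal_lt' lc)).
have QI rho : (Q rho <= \int[mu]_(x in B rho) Phi x + N0)%E.
  have Pm : (\int[mu]_(x in B rho) Phi^\- x <= N0)%E.
    have Phi_neg0 x : (0 <= Phi x)%E -> (Phi^\- x = 0)%E.
      by move=> Px; rewrite funenegE; apply/max_idPr; rewrite leeNl oppe0.
    apply: (@le_trans _ _ (\int[mu]_(x in N rho `|` B eps) Phi^\- x)%E).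
      apply: ge0_integral_ler => // x Bx.
      by have [|] := pselect (B eps x); [right|left].
    apply: le_trans (ge0_integralU_le _ _ _ _) _ => //.
      exact: measurableD.
    have -> : (\int[mu]_(x in N rho) Phi^\- x = 0)%E.
      by apply: integral0_eq => x Nx; apply: Phi_neg0; exact: shell_Phi_ge0 Nx.
    rewrite add0e.
    apply: ge0_integral_le_cst => // x Bx.
    have [Px|] := leP 0%E (Phi x); first by rewrite Phi_neg0// lee_fin.
    rewrite /Phi lte_fin => Px.
    have d0 : fine (dist x) = 0.
      apply/eqP; rewrite eq_le fine_ge0// andbT leNgt; apply/negP => d0.
      by move: Px; rewrite ltNge divr_ge0// ltW// psi_gt0.
    rewrite funenegE ge_max; apply/andP; split; last by rewrite lee_fin.
    rewrite -EFinN lee_fin; apply: le_trans (ler_norm _) _.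
    by rewrite normrN normrM normfV d0 (ger0_norm (f_ge0 x)) ler_wpM2r// fC.
  rewrite integralE -addeA; apply: (@le_trans _ _ (\int[mu]_(x in B rho) Phi^\+ x)%E).
    apply: ge0_integral_ler => //; [by move=> x []|by move=> x; exact: shell_Phi_ge0|].
    by move=> x _; rewrite funeposE le_max lexx.
  have Nn0 : (0 <= \int[mu]_(x in B rho) Phi^\- x)%E.
    by apply: integral_ge0 => x _; exact: funeneg_ge0.
  have Nfin : (\int[mu]_(x in B rho) Phi^\- x)%E \is a fin_num.
    by rewrite ge0_fin_numE// (le_lt_trans Pm)// -ge0_fin_numE ?mule_ge0.
  by rewrite leeDl// addeC sube_ge0// Nfin.
exists (c + fine N0) => rho.
have [rho' [rr cr]] : exists rho', rho <= rho' /\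
    (\int[mu]_(x in B rho') Phi x < c%:E)%E.
  have : \forall rho' \near +oo, rho <= rho' /\
      (\int[mu]_(x in B rho') Phi x < c%:E)%E.
    by near=> rho'; split; near: rho'; [exact: (nbhs_pinfty_ge (num_real _))|exact: cI].
  by move=> /filter_ex.
have := QI rho'; rewrite -(fineK N0fin) => /le_trans H.
apply: (@le_trans _ _ (Q rho')).
  apply: ge0_integral_ler => // x; try exact: shell_Phi_ge0.
  by move=> [xr xe]; split => //; exact: ball_mono xr.
by apply: H; rewrite EFinD leeD2r// ltW.
Unshelve. all: by end_near. Qed.

(** The integral of [Phi] over [N r] is nondecreasing in [r] and bounded; once
    it is within [e] of its supremum, what lies further out contributes at most
    [e]. *)
Lemma shell_integral_small (e : R) : 0 < e ->
  exists r : R, eps <= r /\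
    forall rho, r <= rho -> (\int[mu]_(x in B rho `\` B r) Phi x <= e%:E)%E.
Proof.
move=> e0; have [c Qc] := shell_integrals_bounded.
pose s := ereal_sup (range Q).
have sfin : s \is a fin_num.
  rewrite ge0_fin_numE.
    apply: le_lt_trans (ltry c); apply: ge_ereal_sup => _ [r _ <-]; exact: Qc.
  by apply: le_ereal_sup_tmp; exists (Q 0) => //; exact: shell_integral_ge0.
have [_ [r1 _ <-] Qr1] := ub_ereal_sup_adherent e0 sfin.
exists (Num.max eps r1); split; first by rewrite le_max lexx.
set r := Num.max eps r1 => rho rrho.
have Qfin t : Q t \is a fin_num.
  by rewrite ge0_fin_numE ?shell_integral_ge0// (le_lt_trans (Qc t))// ltry.
have Nr : N r1 `<=` B r by move=> x [xr _]; apply: ball_mono xr; rewrite le_max lexx orbT.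
have : (Q r1 + \int[mu]_(x in B rho `\` B r) Phi x <= Q rho)%E.
  apply: (@le_trans _ _ (\int[mu]_(x in N r1 `|` (B rho `\` B r)) Phi x)%E).
    apply: ge0_integralU_ge.
      by apply/seteqP; split => // x [/Nr xr [_]].
    move=> x [|]; apply: shell_Phi_ge0 => //.
    by rewrite lt_max eps_gt0.
  apply: ge0_integral_ler => //.
  - move=> x [[xr xe]|[xr xe]]; split => //.
      by apply: ball_mono xr; apply: le_trans rrho; rewrite le_max lexx orbT.
    by move=> xe'; apply: xe; apply: ball_mono xe'; rewrite le_max lexx.
  - by move=> x [|]; apply: shell_Phi_ge0 => //; rewrite lt_max eps_gt0.
  - by move=> x; exact: shell_Phi_ge0.
have Qs : (Q rho <= s)%E by apply: ereal_sup_ubound; exists rho.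
move=> /le_trans /(_ Qs); rewrite addeC -leeBrDr// => /le_trans; apply.
by rewrite leeBlDr// addeC -leeBlDr// ltW.
Qed.

(** On [B eps] the integrand is bounded, and on the rest of the ball the weight is
    bounded because it is continuous on [[eps, rho]]. *)
Lemma energy_lty rho : (\int[mu]_(x in B rho) (f x)%:E < +oo)%E.
Proof.
have [c Qc] := shell_integrals_bounded.
have c0 : 0 <= c by have := Qc 0; rewrite -lee_fin; apply: le_trans; exact: shell_integral_ge0.
pose b := Num.max eps rho.
have epsb : eps <= b by rewrite le_max lexx.
have [t _ tmax] : exists2 t, t \in `[eps, b] &
    forall t', t' \in `[eps, b] -> psi t' <= psi t.
  apply: EVT_max => //; apply: continuous_in_subspaceT => t; rewrite inE/= in_itv/=.
  by move=> /andP[te _]; apply: psiC; exact: lt_le_trans te.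
pose D := Num.max (psi t) 1.
have D0 : 0 < D by rewrite lt_max ltr01 orbT.
apply: (@le_lt_trans _ _ (\int[mu]_(x in B eps `|` N rho) (f x)%:E)%E).
  apply: ge0_integral_ler => // [x Bx|x _|x _]; rewrite ?lee_fin//.
  by have [|] := pselect (B eps x); [left|right].
apply: le_lt_trans (ge0_integralU_le _ _ _ _) _ => //.
- exact: measurableD.
- by move=> x _; rewrite lee_fin.
apply: lte_add_pinfty.
  apply: (@le_lt_trans _ _ (C%:E * mu (B eps))%E).
    by apply: ge0_integral_le_cst => // x; rewrite lee_fin//; exact: fC.
  by rewrite lte_mul_pinfty.
apply: le_lt_trans (shell_integral_le (D := D) eps_gt0 D0 _) _.
  move=> t' /andP[et' t'r]; rewrite le_max tmax// in_itv/= et'/=.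
  by rewrite le_max (ltW t'r) orbT.
by apply: lte_mul_pinfty; rewrite ?lee_fin ?(ltW D0)// (le_lt_trans (Qc rho))// ltry.
Qed.

(** Half of [e] is spent on the fixed ball [B r2], whose energy is eventually
    below any positive multiple of [rho^lambda], and half on the shell around it, where
    the weight is at most [D' rho^lambda] and the integral of [Phi] is small. *)
Lemma energy_little_o (lambda : R) (D : R) : 0 < lambda ->
  (\forall r \near +oo, psi r <= D * r `^ lambda) ->
  forall e : R, 0 < e -> \forall rho \near +oo,
    fine (\int[mu]_(x in B rho) (f x)%:E) <= e * rho `^ lambda.
Proof.
move=> l0 psiD e e0; pose D' := Num.max D 1.
have D0 : 0 < D' by rewrite lt_max ltr01 orbT.
have [r1 [er1 Hr1]] := shell_integral_small (divr_gt0 (divr_gt0 e0 (ltr0n _ 2)) D0).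
have [R0 [_ HR0]] := psiD.
pose r2 := Num.max r1 (R0 + 1).
have r1r2 : r1 <= r2 by rewrite le_max lexx.
have r20 : 0 < r2 by rewrite (lt_le_trans eps_gt0)// (le_trans er1).
have Rr2 : R0 < r2 by rewrite lt_max ltrDl ltr01 orbT.
pose K := fine (\int[mu]_(x in B r2) (f x)%:E).
have If rho : (\int[mu]_(x in B rho) (f x)%:E)%E \is a fin_num.
  by rewrite ge0_fin_numE ?energy_lty//; apply: integral_ge0 => x _; rewrite lee_fin.
near=> rho.
have r2rho : r2 <= rho by near: rho; exact: (nbhs_pinfty_ge (num_real _)).
have Krho : K <= e / 2 * rho `^ lambda.
  rewrite mulrC -ler_pdivrMr ?divr_gt0//.
  near: rho; have /cvgryPge := powR_cvgy l0; exact.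
have rl0 : 0 < rho `^ lambda by rewrite powR_gt0// (lt_le_trans r20).
have Dl0 : 0 < D' * rho `^ lambda by rewrite mulr_gt0.
have psi_le t : r2 <= t < rho -> psi t <= D' * rho `^ lambda.
  move=> /andP[tr trho]; have t0 := lt_le_trans r20 tr.
  apply: (@le_trans _ _ (D * t `^ lambda)); first by apply: HR0; exact: lt_le_trans tr.
  apply: (@le_trans _ _ (D' * t `^ lambda)).
    by rewrite ler_wpM2r ?powR_ge0// le_max lexx.
  rewrite ler_wpM2l ?(ltW D0)// ge0_ler_powR ?nnegrE ?(ltW l0)//; apply: ltW => //.
rewrite -lee_fin fineK//.
apply: (@le_trans _ _ (\int[mu]_(x in B r2 `|` (B rho `\` B r2)) (f x)%:E)%E).
  apply: ge0_integral_ler => // [x Bx|x _|x _]; rewrite ?lee_fin//.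
  by have [|] := pselect (B r2 x); [left|right].
apply: le_trans (ge0_integralU_le _ _ _ _) _ => //.
- exact: measurableD.
- by move=> x _; rewrite lee_fin.
have -> : e * rho `^ lambda = e / 2 * rho `^ lambda +
    D' * rho `^ lambda * (e / 2 / D').
  by field; rewrite gt_eqF.
rewrite EFinD; apply: leeD; first by rewrite -(fineK (If r2)) lee_fin.
apply: le_trans (shell_integral_le r20 Dl0 psi_le) _.
rewrite [leRHS]EFinM lee_wpmul2l ?lee_fin ?(ltW Dl0)//.
apply: le_trans (Hr1 rho (le_trans r1r2 r2rho)).
have B0 x : (B rho `\` B r1) x -> (0 <= Phi x)%E.
  by apply: shell_Phi_ge0; exact: lt_le_trans er1.
apply: ge0_integral_ler => //.
  by move=> x [xr xr2]; split => // xr1; apply: xr2; exact: ball_mono xr1.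
by move=> x; exact: shell_Phi_ge0.
Unshelve. all: by end_near. Qed.

End EnergyGrowth.

(** * Differentiability from continuous partial derivatives *)

Lemma cvg_sum (R : realType) (V : normedModType R) (I : finType) (T : Type)
    (F : set_system T) (FF : Filter F) (f : I -> T -> V) (l : I -> V) :
  (forall i, f i x @[x --> F] --> l i) ->
  \sum_i f i x @[x --> F] --> \sum_i l i.
Proof. by move=> fl; apply: cvg_big => [|i _]; [exact: add_continuous|exact: fl]. Qed.

Lemma coord_ler_norm (R : realType) (m n : nat) (A : 'M[R]_(m, n)) i j :
  `|A i j| <= `|A|.
Proof. by rewrite [leRHS]/Num.Def.normr/= mx_normrE; exact: (le_bigmax _ _ (i, j)). Qed.

Lemma mx_norm_ler (R : realType) (m n : nat) (A : 'M[R]_(m, n)) (e : R) :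
  0 <= e -> (forall i j, `|A i j| <= e) -> `|A| <= e.
Proof.
move=> e0 Ae; rewrite [leLHS]/Num.Def.normr/= mx_normrE.
by apply: bigmax_le => // -[i j] _; exact: Ae.
Qed.

(** Mean value theorem for each coordinate of [f] along the line through [z] of
    direction [v]; the supremum norm makes the coordinatewise bounds enough. *)
Lemma derive_along_line_le (R : realType) (n m : nat) (f : 'rV[R]_n -> 'rV[R]_m)
    (z v : 'rV[R]_n) (c : 'rV[R]_m) (eta a : R) :
  0 <= eta ->
  (forall t : R, `|t| <= `|a| -> derivable f (t *: v + z) v /\
     `|'D_v f (t *: v + z) - c| <= eta) ->
  `|f (a *: v + z) - f z - a *: c| <= eta * `|a|.
Proof.
move=> eta0 H; apply: mx_norm_ler; first by rewrite mulr_ge0.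
move=> i j.
pose g (t : R) : R := f (t *: v + z) i j.
pose dg (t : R) : R := 'D_v f (t *: v + z) i j.
have gD (t : R) : `|t| <= `|a| -> is_derive t 1 g (dg t).
  move=> /H[fD _].
  have /derivable_mxP/(_ i j) fijD := fD.
  have gfD : derivable (fun x : R => f (x *: v + z) i j) t 1.
    have E : (fun h : R => f (h *: v + (t *: v + z)) i j) =
        (fun h : R => f ((h *: (1 : R) + t) *: v + z) i j).
      by apply/funext => h; rewrite [_%:A]mulr1 scalerDl addrA.
    by apply/derivable1P; move: fijD => /derivable1P; rewrite E.
  apply: DeriveDef => //.
  rewrite /dg derive_mx// mxE /g /derive.
  have -> : (fun h : R => h^-1 *: (((fun t : R => f (t *: v + z) i j) \o shift t)
      (h *: (1 : R)) - f (t *: v + z) i j)) =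
      (fun h : R => h^-1 *: (((fun t : 'rV_n => f t i j) \o shift (t *: v + z))
      (h *: v) - f (t *: v + z) i j)).
    by apply/funext => h /=; rewrite [_%:A]mulr1 scalerDl addrA.
  by [].
have gc (x y : R) : `|x| <= `|a| -> `|y| <= `|a| -> {within `[x, y], continuous g}.
  move=> xa ya; apply: derivable_within_continuous => t.
  rewrite in_itv/= => /andP[xt ty]; have [] // := gD t.
  rewrite ler_norml; move: xa ya; rewrite !ler_norml => /andP[? ?] /andP[? ?]; lra.
have est (t : R) : `|t| <= `|a| -> `|dg t - c i j| <= eta.
  move=> /H[_]; apply: le_trans; rewrite /dg.
  by apply: le_trans (coord_ler_norm _ i j); rewrite !mxE.
have key : exists2 t, `|t| <= `|a| & g a - g 0 = dg t * a.
  have [a0|a0] := leP 0 a.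
    have [|t| t ta E] := @MVT_segment _ g dg 0 a a0.
    - move=> t; rewrite in_itv/= => /andP[t0 ta]; apply: gD.
      by rewrite !ger0_norm// ltW.
    - by apply: gc => //; rewrite normr0.
    exists t; last by rewrite E subr0.
    by move: ta; rewrite in_itv/= => /andP[t0 ta]; rewrite !ger0_norm.
  have [|t| t ta E] := @MVT_segment _ g dg a 0 (ltW a0).
  - move=> t; rewrite in_itv/= => /andP[t0 ta]; apply: gD.
    by rewrite !ler0_norm ?lerN2// ltW.
  - by apply: gc => //; rewrite normr0.
  exists t; last by rewrite -opprB E sub0r mulrN opprK.
  by move: ta; rewrite in_itv/= => /andP[t0 ta]; rewrite !ler0_norm ?lerN2// ltW.
have [t ta E] := key.
have -> : (f (a *: v + z) - f z - a *: c) i j = (dg t - c i j) * a.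
  rewrite mulrBl -E /g scale0r add0r !mxE [a * _]mulrC.
  by rewrite (ord1 i).
by rewrite normrM ler_wpM2r// est.
Qed.

Lemma differentiable_of_approx (R : realType) (V W : normedModType R) (f : V -> W)
    (L : {linear V -> W}) (x : V) : continuous L ->
  (forall e, 0 < e -> \forall h \near 0, `|f (h + x) - f x - L h| <= e * `|h|) ->
  differentiable f x.
Proof.
move=> Lc H; suff Ho : f \o shift x = cst (f x) + L +o_ 0 id.
  by apply/diff_locallyP; rewrite (diff_unique Lc Ho).
apply/eqaddoP => e e0; near=> h.
have -> : (f \o shift x - (cst (f x) + L)) h = f (h + x) - f x - L h.
  by rewrite [LHS]/= opprD addrA.
by near: h; exact: H.
Unshelve. all: by end_near. Qed.

(** Walk from [y] to [y + h] one coordinate at a time.  On the leg parallel to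
    the axis [s] the partial derivative stays within [eta] of its value at [y],
    so the increment of [f] differs from the linear one by at most
    [eta |h s|]; the [n] legs together err by at most [n eta |h|]. *)
Lemma differentiable_of_partials (R : realType) (n m : nat)
    (f : 'rV[R]_n -> 'rV[R]_m) (O : set 'rV[R]_n) (y : 'rV[R]_n) :
  open O -> O y ->
  (forall z s, O z -> derivable f z (delta_mx 0 s)) ->
  (forall s, {for y, continuous ('D_(delta_mx 0 s) f)}) ->
  differentiable f y.
Proof.
move=> oO Oy fD fC.
pose J := \matrix_(s < n) 'D_(delta_mx 0 s) f y.
pose L : {linear 'rV[R]_n -> 'rV[R]_m} := mulmxr J.
have LE h : L h = \sum_(s < n) h 0 s *: 'D_(delta_mx 0 s) f y.
  by rewrite /L/= mulmx_sum_row; apply: eq_bigr => s _; rewrite rowK.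
have Lc : continuous L.
  have -> : (L : _ -> _) = fun h => \sum_(s < n) h 0 s *: 'D_(delta_mx 0 s) f y.
    by apply/funext => h; rewrite LE.
  move=> h; apply: (cvg_sum (F := nbhs h)) => s.
  by apply: cvgZr_tmp; exact: coord_continuous.
apply: (differentiable_of_approx Lc) => e e0.
pose eta := e / n.+1%:R.
have eta0 : 0 < eta by rewrite divr_gt0.
have [r /= r0 Hr] : exists2 r : R, 0 < r & forall z, `|z - y| < r -> O z /\
    forall s, `|'D_(delta_mx 0 s) f z - 'D_(delta_mx 0 s) f y| <= eta.
  have : \forall z \near y, O z /\ forall s : 'I_n,
      `|'D_(delta_mx 0 s) f z - 'D_(delta_mx 0 s) f y| <= eta.
    near=> z; split; first by near: z; exact: open_nbhs_nbhs.
    near: z; apply: filter_forall => s.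
    by have /cvgrPdistC_le := fC s; apply.
  move=> /nbhs_ballP[r r0 H]; exists r => // z zr; apply: H.
  by rewrite -ball_normE /ball_/= distrC.
near=> h.
have hr : `|h| < r.
  near: h; apply/nbhs_ballP; exists r => // h /=.
  by rewrite -ball_normE /ball_/= sub0r normrN.
(* The corners of the walk: the first k coordinates of h, then zeros. *)
pose p (k : nat) : 'rV[R]_n := \row_j (if (j < k)%N then h 0 j else 0).
have p0 : p 0%N = 0 by apply/rowP => j; rewrite !mxE.
have pn : p n = h by apply/rowP => j; rewrite !mxE ltn_ord.
have pS (s : 'I_n) : p s.+1 = h 0 s *: delta_mx 0 s + p s.
  apply/rowP => j; rewrite !mxE eqxx/= ltnS leq_eqVlt.
  case: (eqVneq j s) => [->|js] /=.
    by rewrite eqxx/= ltnn mulr1 addr0.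
  by rewrite (negbTE (_ : nat_of_ord j != s)) //= mulr0 add0r.
have plt (s : 'I_n) t : `|t| <= `|h 0 s| -> `|t *: delta_mx 0 s + p s| <= `|h|.
  move=> th; apply: mx_norm_ler => // i j; rewrite (ord1 i) !mxE eqxx/=.
  case: (eqVneq j s) => [->|js] /=.
    rewrite ltnn mulr1 addr0 (le_trans th)//; exact: coord_ler_norm.
  rewrite mulr0 add0r; case: ifP => _; last by rewrite normr0.
  exact: coord_ler_norm.
have -> : f (h + y) - f y - L h =
   \sum_(s < n) (f (p s.+1 + y) - f (p s + y) - h 0 s *: 'D_(delta_mx 0 s) f y).
  rewrite sumrB -(LE h).
  have -> : \sum_(i < n) (f (p i.+1 + y) - f (p i + y)) = f (h + y) - f y.
    rewrite -(big_mkord xpredT (fun i => f (p i.+1 + y) - f (p i + y))).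
    rewrite (telescope_sumr (fun i => f (p i + y)))// p0 pn.
    by rewrite add0r.
  by [].
apply: le_trans (ler_norm_sum _ _ _) _.
apply: (@le_trans _ _ (\sum_(s < n) eta * `|h|)).
  apply: ler_sum => s _; rewrite pS -[X in f X - _]addrA.
  have K := @derive_along_line_le _ _ _ f (p s + y) (delta_mx 0 s)
    ('D_(delta_mx 0 s) f y) eta (h 0 s) (ltW eta0).
  have K2 : forall t : R, `|t| <= `|h 0 s| ->
      derivable f (t *: delta_mx 0 s + (p s + y)) (delta_mx 0 s) /\
      `|'D_(delta_mx 0 s) f (t *: delta_mx 0 s + (p s + y)) -
        'D_(delta_mx 0 s) f y| <= eta.
    move=> t th; have [] := Hr (t *: delta_mx 0 s + (p s + y)).
      by rewrite addrA addrK (le_lt_trans (plt s t th)).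
    by move=> Oz /(_ s) D; split => //; exact: fD.
  apply: (le_trans (K K2)).
  by rewrite ler_wpM2l ?(ltW eta0)// coord_ler_norm.
rewrite sumr_const card_ord -mulr_natl mulrA ler_wpM2r// /eta.
rewrite mulrCA ger_pMr// ler_pdivrMr// mul1r ler_nat//.
Unshelve. all: by end_near. Qed.

(** * Arcs, speed and path length *)

(** The primitive of [s] plus [u] has the nonnegative derivative [s + u'] inside
    the interval, hence is nondecreasing. *)
Lemma increment_le_integral (R : realType) (u s : R -> R) :
  (forall t, 0 <= t <= 1 -> {for t, continuous s}) ->
  (forall t, 0 <= t <= 1 -> derivable u t 1 /\ `|derive1 u t| <= s t) ->
  ((u 0 - u 1)%:E <= \int[lebesgue_measure]_(t in `[0%R, 1%R]) (s t)%:E)%E.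
Proof.
move=> sC uD.
have sint : lebesgue_measure.-integrable `[0%R, 1%R] (EFin \o s).
  apply: continuous_compact_integrable; first exact: segment_compact.
  apply: continuous_in_subspaceT => t; rewrite inE /= in_itv/=; exact: sC.
pose F (x : R) : R := (\int[lebesgue_measure]_(t in `[0%R, x]) s t)%R.
have FC : {within `[0%R, 1%R], continuous F}.
  exact: parameterized_integral_continuous.
have FD t : 0 < t < 1 -> derivable F t 1 /\ derive1 F t = s t.
  move=> /andP[t0 t1].
  apply: (continuous_FTC1_closed t1 sint t0).
  by apply: sC; rewrite !ltW.
have F1 : F 1 = fine (\int[lebesgue_measure]_(t in `[0%R, 1%R]) (s t)%:E)%E by [].
have F0 : F 0 = 0 by rewrite /F set_itv1 Rintegral_set1.
rewrite -[leRHS]fineK; last exact: integrable_fin_num.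
rewrite lee_fin -F1.
have := @ger0_derive1_le_cc R (F \+ u) 0 1 _ _ _ 0 1.
have uD' (t : R) : t \in `]0, 1[ -> derivable u t 1 /\ `|derive1 u t| <= s t.
  by rewrite in_itv/= => /andP[t0 t1]; apply: uD; rewrite !ltW.
have FD' (t : R) : t \in `]0, 1[ -> derivable F t 1 /\ derive1 F t = s t.
  by rewrite in_itv/=; apply: FD.
rewrite /= F0 add0r => H; rewrite lerBlDr; apply: H; rewrite ?in_itv/= ?lexx ?ler01//.
- by move=> t tI; apply: derivableD; [have [] := FD' t tI|have [] := uD' t tI].
- move=> t tI; have [Fd FE] := FD' t tI; have [ud uE] := uD' t tI.
  rewrite derive1E deriveD// -!derive1E FE.
  by move: uE; rewrite ler_norml => /andP[]; lra.
- move=> t; apply: cvgD; first exact: FC.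
  apply: continuous_in_subspaceT => {}t; rewrite inE /= in_itv/= => tI.
  by apply/differentiable_continuous/derivable1_diffP; have [] := uD t tI.
Qed.

Section Charts.
Context (R : realType) (n : nat) (M : topologicalType) (S : smooth_manifold R n M).
Implicit Types i j : chart S.

Lemma codomP i y : (phi i @` dom i) y ->
  dom i (phi_inv i y) /\ phi i (phi_inv i y) = y.
Proof. by move=> [x dx <-]; rewrite phiK. Qed.

Lemma nbhs_codom i y : (phi i @` dom i) y -> nbhs y (phi i @` dom i).
Proof. by move=> iy; apply: open_nbhs_nbhs; split => //; exact: codom_open. Qed.

Lemma nbhs_chart_image i (A : set M) y : open A ->
  (phi i @` (dom i `&` A)) y -> nbhs y (phi i @` (dom i `&` A)).
Proof.
move=> oA [x [dx Ax] <-].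
have iy : (phi i @` dom i) (phi i x) by exists x.
near=> z.
have iz : (phi i @` dom i) z by near: z; exact: nbhs_codom.
have [dz zE] := codomP iz.
exists (phi_inv i z) => //; split => //.
near: z; apply: (phi_inv_continuous iy).
by rewrite (phiK dx); exact: open_nbhs_nbhs.
Unshelve. all: by end_near. Qed.

Lemma open_chart_image i (A : set M) : open A -> open (phi i @` (dom i `&` A)).
Proof.
by move=> oA; rewrite openE => y iy; exact: nbhs_chart_image.
Qed.

Lemma transition_differentiable i j x : dom i x -> dom j x ->
  differentiable (phi j \o phi_inv i) (phi i x).
Proof.
move=> dix djx.
have [_ T1] := @transition_smooth _ _ _ S i j 1%N.
have ix : (phi i @` (dom i `&` dom j)) (phi i x) by exists x.
have oO : open (phi i @` (dom i `&` dom j)).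
  by apply: open_chart_image; exact: dom_open.
have T1D z s : (phi i @` (dom i `&` dom j)) z ->
    derivable (phi j \o phi_inv i) z (delta_mx 0 s).
  by move=> Oz; have [H _] := T1 s; exact: H.
have T1C s : {for phi i x, continuous ('D_(delta_mx 0 s) (phi j \o phi_inv i))}.
  by have [_ [H _]] := T1 s; exact: H.
exact: (@differentiable_of_partials R n n (phi j \o phi_inv i) _ _ oO ix T1D T1C).
Qed.

Context (g : riemannian_metric S).

Lemma quadE (u : 'rV[R]_n) (G : 'M[R]_n) :
  (u *m G *m u^T) 0 0 = \sum_s \sum_t u 0 t * G t s * u 0 s.
Proof.
rewrite mxE; apply: eq_bigr => s _; rewrite !mxE mulr_suml.
by apply: eq_bigr.
Qed.

Lemma gram_continuous i y s t : (phi i @` dom i) y ->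
  {for y, continuous (fun y => gram g i (phi_inv i y) s t)}.
Proof.
move=> iy; have [H _] := @gram_smooth _ _ _ _ g i s t 0%N.
by apply: H; rewrite setIT.
Qed.

Lemma speed_continuous i (c : R -> 'rV[R]_n) t : C1_curve c ->
  (phi i @` dom i) (c t) -> {for t, continuous (speed g i c)}.
Proof.
move=> [cD c'C] ict; rewrite /speed.
apply: continuous_comp; last exact: sqrt_continuous.
have -> : (fun t => (derive1 c t *m gram g i (phi_inv i (c t)) *m (derive1 c t)^T) 0 0)
  = fun t => \sum_s \sum_r
      derive1 c t 0 r * gram g i (phi_inv i (c t)) r s * derive1 c t 0 s.
  by rewrite funeqE => x; rewrite quadE.
have cC : {for t, continuous c}.
  exact/differentiable_continuous/derivable1_diffP.
have c'sC s : {for t, continuous (fun t => derive1 c t 0 s)}.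
  exact: (@continuous_comp _ _ _ (derive1 c) (fun A : 'rV[R]_n => A 0 s) t
    (c'C t) (@coord_continuous R 1 n 0 s _)).
apply: (cvg_sum (F := nbhs t)) => s; apply: (cvg_sum (F := nbhs t)) => r.
apply: cvgM; last exact: c'sC.
apply: cvgM; first exact: c'sC.
have H := @continuous_comp _ _ _ c (fun y => gram g i (phi_inv i y) r s) t cC
  (@gram_continuous i (c t) r s ict).
exact: H.
Qed.

(** The Jacobian that the chain rule produces for the velocity is the one by
    which the Gram matrices of the two charts differ. *)
Lemma curve_in_other_chart i j (c : R -> 'rV[R]_n) t : C1_curve c ->
  (phi i @` dom i) (c t) -> dom j (phi_inv i (c t)) ->
  derivable (phi j \o phi_inv i \o c) t 1 /\
  speed g i c t = speed g j (phi j \o phi_inv i \o c) t.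
Proof.
move=> [cD _] ict jct; have [ict' E] := codomP ict.
have Td : differentiable (phi j \o phi_inv i) (c t).
  by rewrite -E; apply: transition_differentiable.
have cd : differentiable c t by exact/derivable1_diffP.
have gd : differentiable (phi j \o phi_inv i \o c) t.
  exact: differentiable_comp.
split; first exact/derivable1_diffP.
rewrite /speed; congr Num.sqrt.
rewrite (gram_transition g ict' jct) /transition_jacobian E /= (phiK jct).
suff -> : derive1 (phi j \o phi_inv i \o c) t =
   derive1 c t *m jacobian (phi j \o phi_inv i) (c t).
  by rewrite trmx_mul !mulmxA.
have dE := @diff_comp _ _ _ _ c (phi j \o phi_inv i) t cd Td.
have gE := @deriveE _ _ _ (phi j \o phi_inv i \o c) t 1 gd.
have cE := @deriveE _ _ _ c t 1 cd.
by rewrite [LHS]derive1E gE dE derive1E cE /jacobian mul_rV_lin1.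
Qed.

Lemma path_length_ge0 x y l : path_length g x y l -> (0 <= l)%E.
Proof.
elim=> // i c {}y {}l cC ic _ l0; apply: adde_ge0 => //.
by apply: integral_ge0 => t _; rewrite lee_fin sqrtr_ge0.
Qed.

Lemma geodesic_dist_ge0 x y : (0 <= geodesic_dist g x y)%E.
Proof. by apply: le_ereal_inf_tmp => l /path_length_ge0. Qed.

(** Lower bounds on the geodesic distance come from here: a function whose
    derivative along every arc is at most the speed is 1-Lipschitz. *)
Lemma increment_le_path_length (f : M -> R) x y l :
  (forall i (c : R -> 'rV[R]_n) t, C1_curve c -> (phi i @` dom i) (c t) ->
     derivable (f \o phi_inv i \o c) t 1 /\
     `|derive1 (f \o phi_inv i \o c) t| <= speed g i c t) ->
  path_length g x y l -> ((f x - f y)%:E <= l)%E.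
Proof.
move=> fD; elim=> [z|i c {}y {}l cC ic _ IH]; first by rewrite subrr.
have H := @increment_le_integral R (f \o phi_inv i \o c) (speed g i c).
rewrite -(subrK (f (phi_inv i (c 1))) (f (phi_inv i (c 0)))) -addrA EFinD.
apply: leeD => //; apply: H => t t01; first exact: speed_continuous cC (ic t t01).
exact: fD cC (ic t t01).
Qed.

End Charts.

(** * A differentiable bump function *)

(** The square makes the positive part differentiable at 0. *)
Definition pos_sqr (R : realType) (z : R) : R := Num.max z 0 ^+ 2.

Lemma is_derive_pos_sqr (R : realType) (z : R) :
  is_derive z (1 : R) (@pos_sqr R) (2 * Num.max z 0).
Proof.
have [z0|z0|->] := ltrgtP z 0.
- have cD : is_derive z (1 : R) (cst (0 : R)) (0 : R) by exact: is_derive_cst.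
  rewrite mulr0; apply: near_eq_is_derive cD.
  near=> x; rewrite /pos_sqr max_r ?expr0n//.
  by near: x; exact: lt_le_nbhsl.
- have sD : is_derive z (1 : R) ((@id R) ^+ 2) (2 * z).
    by apply: is_derive_eq; rewrite /= expr1 [_ *: _]mulr1.
  apply: near_eq_is_derive sD.
  near=> x; rewrite /pos_sqr max_l//.
  by near: x; apply: (cvgr_ge z) => //; exact: cvg_id.
- rewrite mulr0.
  have L : h^-1 *: ((@pos_sqr R \o shift 0) (h *: (1 : R)) - pos_sqr 0)
      @[h --> (0 : R)^'] --> (0 : R).
    apply/cvgrPdist_le => e e0; near=> h.
    have h0 : h != 0 by near: h; exact: nbhs_dnbhs_neq.
    rewrite /= [_%:A]mulr1 addr0 /pos_sqr maxxx expr0n/= subr0 sub0r normrN.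
    rewrite normrZ normrX normfV ler_pdivrMl ?normr_gt0//.
    have m : `|Num.max h 0| <= `|h|.
      by have [_|_] := leP h 0; rewrite ?normr0.
    rewrite expr2 ler_pM// (le_trans m)//.
    by near: h; exact: dnbhs0_le.
  by apply: DeriveDef; [apply/cvg_ex; exists 0|exact: cvg_lim].
Unshelve. all: by end_near. Qed.

(** For positive [delta], the support is the closed Euclidean ball of radius
    [delta] around [y0], which lies in the closed ball of the supremum norm. *)
Definition bump (R : realType) (n : nat) (y0 : 'rV[R]_n) (delta : R) (z : 'rV[R]_n) : R :=
  pos_sqr (delta ^+ 2 - \sum_s (z 0 s - y0 0 s) ^+ 2).

Lemma bump_gt0_norm (R : realType) (n : nat) (y0 z : 'rV[R]_n) (delta : R) :
  0 < delta -> 0 < bump y0 delta z -> `|z - y0| <= delta.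
Proof.
move=> d0; rewrite /bump /pos_sqr => H.
have : 0 < delta ^+ 2 - \sum_s (z 0 s - y0 0 s) ^+ 2.
  by move: H; have [//|_] := ltP 0 (delta ^+ 2 - _); rewrite expr0n ltxx.
rewrite subr_gt0 => {}H; apply: mx_norm_ler; first exact: ltW.
move=> i s; rewrite (ord1 i) !mxE.
rewrite -ler_sqr ?nnegrE ?(ltW d0)// -normrX ger0_norm ?sqr_ge0//.
apply: le_trans (ltW H); rewrite (bigD1 s)//= lerDl sumr_ge0// => *.
exact: sqr_ge0.
Qed.

(** Where the bump is positive, [c t] is within [delta] of [y0] in each
    coordinate: the outer derivative is at most [2 delta^2] and the inner one at
    most [2 n delta |c'|].  Where the bump is zero it is minimal, so its
    derivative vanishes; this covers positions [c t] about which nothing else is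
    known. *)
Lemma bump_curve (R : realType) (n : nat) (y0 : 'rV[R]_n) (delta : R)
    (c : R -> 'rV[R]_n) (t : R) : 0 < delta -> derivable c t 1 ->
  [/\ derivable (bump y0 delta \o c) t 1,
      `|derive1 (bump y0 delta \o c) t| <= 4 * n%:R * delta ^+ 3 * `|derive1 c t| &
      bump y0 delta (c t) <= 0 -> derive1 (bump y0 delta \o c) t = 0].
Proof.
move=> d0 cD.
pose q (x : R) : R := delta ^+ 2 - \sum_s (c x 0 s - y0 0 s) ^+ 2.
pose dq : R := - \sum_s 2 * (c t 0 s - y0 0 s) * derive1 c t 0 s.
have csD s : is_derive t (1 : R) (fun x => c x 0 s) (derive1 c t 0 s).
  apply: DeriveDef; first by move/derivable_mxP : cD; exact.
  by rewrite derive1E derive_mx// mxE.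
have qD : is_derive t (1 : R) q dq.
  have -> : q = cst (delta ^+ 2) -
      \sum_(s < n) ((fun x => c x 0 s) - cst (y0 0 s)) ^+ 2.
    apply/funext => x; rewrite /q /= fct_sumE; congr (_ - _).
  apply: is_derive_eq; rewrite /dq sub0r; congr (- _); apply: eq_bigr => s _.
  by rewrite subr0 expr1.
have pD := is_derive1_comp (is_derive_pos_sqr (q t)) qD.
have -> : bump y0 delta \o c = @pos_sqr R \o q by [].
have dE : derive1 (@pos_sqr R \o q) t = 2 * Num.max (q t) 0 * dq.
  by rewrite derive1E derive_val.
split; first exact: ex_derive; last first.
  rewrite dE /bump -/(q t) /pos_sqr => H; have [q0|q0] := leP (q t) 0.
    by rewrite mulr0 mul0r.
  by move: H; rewrite max_l ?(ltW q0)// leNgt exprn_gt0.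
rewrite dE.
have [q0|q0] := leP (q t) 0; first by rewrite mulr0 mul0r normr0 !mulr_ge0// ltW.
have cd s : `|c t 0 s - y0 0 s| <= delta.
  have := @bump_gt0_norm _ _ y0 (c t) delta d0.
  have qp : 0 < bump y0 delta (c t).
    by rewrite /bump -/(q t) /pos_sqr max_l ?exprn_gt0// ltW.
  move=> /(_ qp); apply: le_trans.
  by have := coord_ler_norm (c t - y0) 0 s; rewrite !mxE.
have qd : q t <= delta ^+ 2.
  by rewrite lerBlDr lerDl sumr_ge0// => *; exact: sqr_ge0.
have dqd : `|dq| <= 2 * n%:R * delta * `|derive1 c t|.
  rewrite /dq normrN; apply: le_trans (ler_norm_sum _ _ _) _.
  apply: (@le_trans _ _ (\sum_(s < n) 2 * delta * `|derive1 c t|)).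
    apply: ler_sum => s _; rewrite !normrM ger0_norm//.
    rewrite ler_pM// ?mulr_ge0 ?ler_wpM2l//.
    exact: coord_ler_norm.
  by rewrite sumr_const card_ord -[leLHS]mulr_natl !mulrA [n%:R * 2]mulrC.
rewrite !normrM (ger0_norm (ler0n _ 2)) (ger0_norm (ltW q0)).
apply: (@le_trans _ _ (2 * delta ^+ 2 * (2 * n%:R * delta * `|derive1 c t|))).
  by rewrite ler_pM// ?mulr_ge0 ?(ltW q0)// ler_wpM2l.
rewrite le_eqVlt; apply/orP; left; apply/eqP; ring.
Qed.

(** * Small geodesic balls lie in coordinate neighbourhoods *)

Section SmallBalls.
Context (R : realType) (n : nat) (M : topologicalType) (S : smooth_manifold R n M).
Context (g : riemannian_metric S).
Implicit Types i j : chart S.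

Lemma quad_diff_le (u : 'rV[R]_n) (G H : 'M[R]_n) (e : R) :
  (forall s t, `|G s t - H s t| <= e) ->
  `|(u *m G *m u^T) 0 0 - (u *m H *m u^T) 0 0| <= n%:R * n%:R * e * `|u| ^+ 2.
Proof.
move=> GH; rewrite !quadE -sumrB.
apply: le_trans (ler_norm_sum _ _ _) _.
apply: (@le_trans _ _ (\sum_(s < n) n%:R * e * `|u| ^+ 2)); last first.
  by rewrite sumr_const card_ord -[leLHS]mulr_natl !mulrA.
apply: ler_sum => s _; rewrite -sumrB.
apply: le_trans (ler_norm_sum _ _ _) _.
apply: (@le_trans _ _ (\sum_(s < n) e * `|u| ^+ 2)); last first.
  by rewrite sumr_const card_ord -[leLHS]mulr_natl !mulrA.
apply: ler_sum => t _; rewrite -mulrBl -mulrBr !normrM mulrAC mulrC.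
rewrite ler_pM ?mulr_ge0//.
by rewrite expr2 ler_pM// coord_ler_norm.
Qed.

(** On the compact unit sphere the form is positive, so its values stay away
    from 0; homogeneity extends the bound to all vectors. *)
Lemma posdef_coercive (G : 'M[R]_n) :
  (forall u : 'rV[R]_n, u != 0 -> 0 < (u *m G *m u^T) 0 0) ->
  exists2 k : R, 0 < k & forall u : 'rV[R]_n, k * `|u| ^+ 2 <= (u *m G *m u^T) 0 0.
Proof.
move=> Gpos; pose Q (u : 'rV[R]_n) : R := (u *m G *m u^T) 0 0.
have QC : continuous Q.
  have -> : Q = fun u : 'rV[R]_n => \sum_s \sum_t u 0 t * G t s * u 0 s.
    by apply/funext => u; rewrite /Q quadE.
  move=> u; apply: (cvg_sum (F := nbhs u)) => s; apply: (cvg_sum (F := nbhs u)) => t.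
  by apply: cvgM; [apply: cvgM; [|exact: cvg_cst]|]; exact: coord_continuous.
pose A := [set u : 'rV[R]_n | `|u| = 1].
have cA : compact A.
  apply: bounded_closed_compact.
    by exists 1; split => // x x1 u /= ->; exact: ltW.
  have -> : A = (fun u : 'rV[R]_n => `|u|) @^-1` [set 1] by [].
  apply: closed_comp => [u _|]; first exact: norm_continuous.
  exact: closed_eq.
have cQA : compact (Q @` A).
  by apply: continuous_compact => //; exact: continuous_subspaceT.
have [r /= r0 Hr] : exists2 r : R, 0 < r & forall u, `|u| = 1 -> r <= Q u.
  have oQ : open (~` (Q @` A)).
    by apply: closed_openC; apply: compact_closed cQA; exact: order_hausdorff.
  have Q0 : (~` (Q @` A)) 0.
    move=> [u u1 Qu]; have : u != 0 by rewrite -normr_eq0 u1 oner_eq0.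
    by move/Gpos; rewrite -/(Q u) Qu ltxx.
  have /nbhs_ballP[r r0 Br] : nbhs 0 (~` (Q @` A)) by exact: open_nbhs_nbhs.
  exists r => // u u1; rewrite leNgt; apply/negP => Qr.
  have un0 : u != 0 by rewrite -normr_eq0 u1 oner_eq0.
  apply: (Br (Q u)); last by exists u.
  by rewrite /ball/= sub0r normrN ger0_norm// ltW// Gpos.
have QZ a u : Q (a *: u) = a ^+ 2 * Q u.
  rewrite /Q [(a *: u)^T]linearZ/= -!scalemxAl -scalemxAr mxE [in LHS]mxE mulrA.
  by rewrite -expr2.
exists r => // u; have [->|u0] := eqVneq u 0.
  by rewrite normr0 expr0n mulr0 mul0mx mxE big1// => s _; rewrite mxE mul0r.
pose v := `|u|^-1 *: u.
have v1 : `|v| = 1.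
  by rewrite normrZ normfV normr_id mulVf// normr_eq0.
have -> : u = `|u| *: v by rewrite scalerA divff ?scale1r// normr_eq0.
rewrite -/(Q _) QZ.
by rewrite normrZ normr_id v1 mulr1 mulrC ler_wpM2l ?sqr_ge0//; exact: Hr.
Qed.

(** Changing the entries of the Gram matrix by at most [e] changes the quadratic
    form by at most [n^2 e |u|^2], so half of the constant at [y] survives
    nearby. *)
Lemma gram_coercive_near i y : (phi i @` dom i) y ->
  exists2 k : R, 0 < k & \forall z \near y, forall u : 'rV[R]_n,
     k * `|u| ^+ 2 <= (u *m gram g i (phi_inv i z) *m u^T) 0 0.
Proof.
move=> iy; have [dy _] := codomP iy.
have [k k0 Hk] := posdef_coercive (fun u => gram_posdef g (u := u) dy).
exists (k / 2); first by rewrite divr_gt0.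
pose e := k / 2 / (n * n).+1%:R.
have e0 : 0 < e by rewrite !divr_gt0.
near=> z => u.
have ze s t : `|gram g i (phi_inv i z) s t - gram g i (phi_inv i y) s t| <= e.
  move: s t; near: z; apply: filter_forall => s; apply: filter_forall => t.
  have /cvgrPdistC_le := @gram_continuous R n M S g i y s t iy.
  exact.
have := quad_diff_le u ze; rewrite ler_distl => /andP[H _].
apply: le_trans H; rewrite -(lerD2r (n%:R * n%:R * e * `|u| ^+ 2)) subrK -mulrDl.
apply: le_trans (Hk u); rewrite ler_wpM2r ?sqr_ge0//.
rewrite [leRHS](splitr k) lerD2l /e -natrM mulrA.
by rewrite mulrAC ger_pMl ?divr_gt0// ler_pdivrMr// mul1r ler_nat.
Unshelve. all: by end_near. Qed.

Lemma closed_norm_le (y : 'rV[R]_n) (d : R) : closed [set z | `|z - y| <= d].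
Proof.
have -> : [set z | `|z - y| <= d] =
    (fun z : 'rV[R]_n => `|z - y|) @^-1` [set x | x <= d] by [].
apply: closed_comp => [z _|]; last exact: closed_le.
apply: (@continuous_comp _ _ _ (fun z : 'rV[R]_n => z - y) (fun z => `|z|)).
  apply: (@continuousB _ _ _ (@id 'rV[R]_n) (cst y) z).
    by move=> P.
  exact: cst_continuous.
exact: norm_continuous.
Qed.

(** A compact subset of a Hausdorff space is closed, although the image is taken
    under a chart that covers only part of [M]. *)
Lemma closed_image_ball i y (d : R) :
  (forall z, `|z - y| <= d -> (phi i @` dom i) z) ->
  closed (phi_inv i @` [set z | `|z - y| <= d]).
Proof.
move=> Bi; apply: compact_closed; first exact: manifold_hausdorff S.
apply: continuous_compact.
  apply: continuous_in_subspaceT => z /[!inE] /Bi; exact: phi_inv_continuous.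
apply: bounded_closed_compact; last exact: closed_norm_le.
exists (d + `|y|); split; first exact: num_real.
move=> r rd z /= zd; apply: le_trans (ltW rd).
by rewrite -[z](subrK y) (le_trans (ler_normD _ _))// lerD2r.
Qed.

(** The bump [f], extended by zero outside the chart and divided by a bound [L]
    for the ratio of its derivative to the speed, is 1-Lipschitz.  A point closer
    to [x0] than [f x0] therefore has [f > 0], which puts it in the coordinate
    ball and hence in [U]. *)
Lemma geodesic_ball_sub_nbhs (x0 : M) (U : set M) : nbhs x0 U ->
  exists2 eps : R, 0 < eps & geodesic_ball g x0 eps `<=` U.
Proof.
move=> Ux0; have [i dx0] := dom_cover S x0; pose y0 := phi i x0.
have iy0 : (phi i @` dom i) y0 by exists x0.
have [k k0 Hk] := gram_coercive_near iy0.
have [d d0 Hd] : exists2 d : R, 0 < d & forall z, `|z - y0| <= d ->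
    [/\ (phi i @` dom i) z, U (phi_inv i z) &
      forall u : 'rV[R]_n,
        k * `|u| ^+ 2 <= (u *m gram g i (phi_inv i z) *m u^T) 0 0].
  have : \forall z \near y0, [/\ (phi i @` dom i) z, U (phi_inv i z) &
      forall u : 'rV[R]_n,
        k * `|u| ^+ 2 <= (u *m gram g i (phi_inv i z) *m u^T) 0 0].
    near=> z; split; [by near: z; exact: nbhs_codom| |by near: z; exact: Hk].
    by near: z; apply: (phi_inv_continuous iy0); rewrite phiK.
  move=> /nbhs_ballP[d /= d0 H]; exists (d / 2); first by rewrite divr_gt0.
  move=> z zd; apply: H; rewrite -ball_normE /ball_/= distrC.
  by rewrite (le_lt_trans zd)// ltr_pdivrMr// ltr_pMr// ltr1n.
have cK := closed_image_ball (fun z zd => let: And3 H _ _ := Hd z zd in H).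
set K := (X in closed X) in cK.
(* Derivative of the bump over velocity, times velocity over speed; adding 1
   makes L positive even in dimension 0. *)
pose L := 4 * n%:R * d ^+ 3 / Num.sqrt k + 1.
have L0 : 0 < L by rewrite ltr_wpDl// divr_ge0 ?sqrtr_ge0// !mulr_ge0// ltW.
pose f (x : M) : R := if x \in dom i then L^-1 * bump y0 d (phi i x) else 0.
have f_gt0 x : 0 < f x -> dom i x /\ `|phi i x - y0| <= d.
  rewrite /f; have [/set_mem dx|_] := boolP (x \in dom i); last by rewrite ltxx.
  rewrite pmulr_rgt0 ?invr_gt0// => H; split => //.
  exact: bump_gt0_norm H.
have fx0 : 0 < f x0.
  rewrite /f mem_set// mulr_gt0 ?invr_gt0// /bump big1 => [|s _].
    by rewrite subr0 /pos_sqr max_l ?exprn_gt0// sqr_ge0.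
  by rewrite subrr expr0n.
exists (f x0) => // x; rewrite /geodesic_ball/= => /ereal_inf_lt[l xl lf].
suff /f_gt0[dx xd] : 0 < f x by have [_ + _] := Hd _ xd; rewrite (phiK dx).
suff : ((f x0 - f x)%:E <= l)%E.
  by move=> /le_lt_trans /(_ lf); rewrite lte_fin; lra.
apply: increment_le_path_length xl => j c t cC jct.
have [dj jE] := codomP jct.
have cct : {for t, continuous c}.
  by apply/differentiable_continuous/derivable1_diffP; have [] := cC.
have pcC : {for t, continuous (phi_inv j \o c)}.
  exact: (@continuous_comp _ _ _ c (phi_inv j) t cct (phi_inv_continuous jct)).
have [dix|dix] := pselect (dom i (phi_inv j (c t))).
  have [gD gE] := curve_in_other_chart g cC jct dix.
  rewrite gE {gE}; set c' := phi i \o phi_inv j \o c in gD *.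
  have [bD bE b0] := bump_curve y0 d0 gD; move=> {gD}.
  have fD : is_derive t 1 (f \o phi_inv j \o c) (L^-1 * derive1 (bump y0 d \o c') t).
    have lD : is_derive t (1 : R) (L^-1 \*: (bump y0 d \o c'))
        (L^-1 * derive1 (bump y0 d \o c') t).
      by apply: is_deriveZ; rewrite derive1E; exact: derivableP.
    apply: near_eq_is_derive lD; near=> r.
    rewrite /f /= mem_set//; near: r; apply: pcC.
    by apply: open_nbhs_nbhs; split => //; exact: dom_open.
  split; first exact: ex_derive.
  rewrite derive1E derive_val normrM gtr0_norm ?invr_gt0// ler_pdivrMl//.
  have [q0|q0] := ltP 0 (bump y0 d (c' t)); last first.
    by rewrite (b0 q0) normr0 mulr_ge0 ?sqrtr_ge0// ltW.
  have cd := bump_gt0_norm d0 q0.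
  have [_ _ /(_ (derive1 c' t))] := Hd _ cd.
  move=> kq; have := kq; rewrite -ler_sqrt; last first.
    by rewrite (le_trans _ kq)// mulr_ge0 ?sqr_ge0// ltW.
  rewrite sqrtrM ?(ltW k0)// sqrtr_sqr normr_id => kE.
  have {kE} : Num.sqrt k * `|derive1 c' t| <= speed g i c' t by exact: kE.
  have : 0 <= speed g i c' t by exact: sqrtr_ge0.
  move: (speed g i c' t) => s s0 kE; apply: (le_trans bE).
  apply: (@le_trans _ _ (4 * n%:R * d ^+ 3 / Num.sqrt k * s)); last first.
    by apply: ler_wpM2r => //; rewrite /L lerDl ler01.
  rewrite -[leRHS]mulrA ler_wpM2l ?mulr_ge0 ?(ltW d0)//.
  by rewrite ler_pdivlMl ?sqrtr_gt0.
(* Off the chart the arc avoids the closed set K for a while, so f is locally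
   zero along it. *)
have Kx : (~` K) (phi_inv j (c t)).
  by move=> [z /Hd[iz _ _] zE]; apply: dix; rewrite -zE; have [] := codomP iz.
have zD : is_derive t (1 : R) (cst (0 : R)) (0 : R) by exact: is_derive_cst.
have fD : is_derive t 1 (f \o phi_inv j \o c) (0 : R).
  apply: near_eq_is_derive zD; near=> r.
  have : (~` K) (phi_inv j (c r)).
    by near: r; apply: pcC; apply: open_nbhs_nbhs; split => //; exact: closed_openC.
  rewrite /= /f; case: ifPn => // /set_mem dx Kx'.
  suff -> : bump y0 d (phi i (phi_inv j (c r))) = 0 by rewrite mulr0.
  apply/eqP; rewrite eq_le sqr_ge0 andbT leNgt; apply/negP => /(bump_gt0_norm d0) xd.
  by apply: Kx'; exists (phi i (phi_inv j (c r))) => //; rewrite phiK.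
split; first exact: ex_derive.
by rewrite derive1E derive_val normr0 sqrtr_ge0.
Unshelve. all: by end_near. Qed.

End SmallBalls.

(** * Geodesic balls are open *)

Section OpenBalls.
Context (R : realType) (n : nat) (M : topologicalType) (S : smooth_manifold R n M).
Context (g : riemannian_metric S).
Implicit Types i j : chart S.

Lemma path_length_cat x y z (l l' : \bar R) :
  path_length g x y l -> path_length g y z l' -> path_length g x z (l + l')%E.
Proof.
elim=> [w|i c {}y {}l cC ic _ IH] yz; first by rewrite add0e.
by rewrite -addeA; apply: path_cons => //; exact: IH.
Qed.

Lemma is_derive_segment (a b : 'rV[R]_n) (t : R) :
  is_derive t (1 : R) (fun t : R => a + t *: b) b.
Proof.
have L : h^-1 *: (((fun t : R => a + t *: b) \o shift t) (h *: (1 : R)) - (a + t *: b))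
    @[h --> (0 : R)^'] --> b.
  apply/cvgrPdist_le => e e0; near=> h.
  have h0 : h != 0 by near: h; exact: nbhs_dnbhs_neq.
  rewrite /= [_%:A]mulr1 opprD addrACA subrr add0r -scalerBl addrK.
  by rewrite scalerA mulVf// scale1r subrr normr0 ltW.
by apply: DeriveDef; [apply/cvg_ex; exists b|exact: cvg_lim].
Unshelve. all: by end_near. Qed.

(** In a chart, the straight segment from [x] to [y] has speed at most
    [n sqrt B] times its coordinate length, where [B] bounds the entries of the
    Gram matrix near [x]. *)
Lemma short_path_near x (e : R) : 0 < e ->
  \forall y \near x, exists2 l, path_length g x y l & (l <= e%:E)%E.
Proof.
move=> e0; have [i dx] := dom_cover S x; pose a := phi i x.
have ia : (phi i @` dom i) a by exists x.
pose B := \sum_s \sum_t `|gram g i x s t| + 1.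
have Bge s t : `|gram g i x s t| + 1 <= B.
  rewrite lerD2r (bigD1 s)//= (bigD1 t)//= -addrA lerDl.
  rewrite addr_ge0// sumr_ge0// => *; exact: sumr_ge0.
have B0 : 0 <= B by rewrite addr_ge0// sumr_ge0// => *; exact: sumr_ge0.
have [d d0 Hd] : exists2 d : R, 0 < d & forall z, `|z - a| < d ->
    (phi i @` dom i) z /\ forall s t, `|gram g i (phi_inv i z) s t| <= B.
  have : \forall z \near a, (phi i @` dom i) z /\
      forall s t, `|gram g i (phi_inv i z) s t| <= B.
    near=> z; split; first by near: z; exact: nbhs_codom.
    near: z; apply: filter_forall => s; apply: filter_forall => t.
    have /cvgrPdistC_le/(_ 1 ltr01) := @gram_continuous R n M S g i a s t ia.
    apply: filterS => z; rewrite [phi_inv i a]phiK// => zE; apply: le_trans (Bge s t).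
    rewrite -[gram g i (phi_inv i z) s t](subrK (gram g i x s t)) addrC.
    by rewrite (le_trans (ler_normD _ _))// lerD2l.
  move=> /nbhs_ballP[d /= d0 H]; exists d => //.
  by move=> z zd; apply: H; rewrite -ball_normE /ball_/= distrC.
pose C := n%:R * n%:R * B.
have C0 : 0 <= C by rewrite !mulr_ge0.
pose m := Num.min d (e / (Num.sqrt C + 1)).
have sC0 : 0 < Num.sqrt C + 1 by rewrite ltr_wpDl ?sqrtr_ge0.
have m0 : 0 < m by rewrite lt_min d0 divr_gt0.
have nbx : \forall y \near x, dom i y /\ `|phi i y - a| < m.
  near=> y; split.
    by near: y; apply: open_nbhs_nbhs; split => //; exact: dom_open.
  near: y; have /cvgrPdistC_lt := @phi_continuous _ _ _ S i x dx.
  exact.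
apply: filterS nbx => y [dy ym]; pose b := phi i y - a.
pose c (t : R) : 'rV[R]_n := a + t *: b.
have bd : `|b| < d by rewrite (lt_le_trans ym)// /m ge_min lexx.
have be : (Num.sqrt C + 1) * `|b| <= e.
  rewrite -ler_pdivlMl// mulrC ltW// (lt_le_trans ym)//.
  by rewrite /m ge_min lexx orbT.
have c'E : derive1 c = cst b.
  apply/funext => t; rewrite derive1E.
  exact: (@derive_val _ _ _ _ _ _ _ (is_derive_segment a b t)).
have cC : C1_curve c.
  split; last by rewrite c'E => t; exact: cst_continuous.
  by move=> t; exact: (@ex_derive _ _ _ _ _ _ _ (is_derive_segment a b t)).
have cd t : 0 <= t <= 1 -> `|c t - a| < d.
  move=> /andP[t0 t1]; rewrite /c addrC addKr normrZ ger0_norm//.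
  by apply: le_lt_trans bd; rewrite ler_piMl.
have ic t : 0 <= t <= 1 -> (phi i @` dom i) (c t) by move=> /cd /Hd[].
have c0E : phi_inv i (c 0) = x by rewrite /c scale0r addr0 phiK.
have c1E : phi_inv i (c 1) = y by rewrite /c scale1r addrC subrK phiK.
have P : path_length g (phi_inv i (c 1)) y 0%E by rewrite c1E; exact: path_nil.
have := path_cons cC ic P; rewrite c0E => Px.
eexists; first exact: Px.
rewrite adde0.
have se t : 0 <= t <= 1 -> speed g i c t <= e.
  move=> /cd /Hd[_ GB]; apply: le_trans be; rewrite /speed c'E /=.
  have := @quad_diff_le R n b (gram g i (phi_inv i (c t))) 0 B.
  have -> : (b *m 0 *m b^T) 0 0 = 0 by rewrite mulmx0 mul0mx mxE.
  rewrite subr0 => H.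
  apply: (@le_trans _ _ (Num.sqrt (C * `|b| ^+ 2))).
    apply: ler_wsqrtr; apply: le_trans (ler_norm _) _.
    by apply: H => s t'; rewrite mxE subr0.
  by rewrite sqrtrM// sqrtr_sqr normr_id ler_wpM2r// lerDl.
apply: (@le_trans _ _ (e%:E * lebesgue_measure `[0%R, 1%R]%classic)%E).
  apply: ge0_integral_le_cst => //.
  - by rewrite ltW.
  - by move=> t _; rewrite lee_fin sqrtr_ge0.
by rewrite lebesgue_measure_itv/= lte_fin ltr01 oppr0 adde0 mule1.
Unshelve. all: by end_near. Qed.

(** A path from [x0] to [x] shorter than [rho] can be prolonged by a short path
    to any point near [x]. *)
Lemma open_geodesic_ball x0 (rho : R) : open (geodesic_ball g x0 rho).
Proof.
rewrite openE => x; rewrite /geodesic_ball/= => /ereal_inf_lt[l x0x lr].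
have l0 := path_length_ge0 x0x.
have lfin : l \is a fin_num by rewrite ge0_fin_numE// (lt_trans lr)// ltry.
have e0 : 0 < (rho - fine l) / 2.
  by rewrite divr_gt0// subr_gt0 -lte_fin fineK.
rewrite /interior; apply: filterS (short_path_near x e0) => y [l' xy l'e] /=.
apply: le_lt_trans (ereal_inf_lbound (path_length_cat x0x xy)) _.
apply: (@le_lt_trans _ _ (l + ((rho - fine l) / 2)%:E)%E); first by rewrite leeD2l.
rewrite -[l]fineK// -EFinD lte_fin.
by move: e0; rewrite /= ; lra.
Qed.

End OpenBalls.

(** * Local finiteness of the volume *)

Section LocalBounds.
Context (R : realType) (n : nat) (M : topologicalType) (S : smooth_manifold R n M).
Context (g : riemannian_metric S).
Implicit Types i j : chart S.

(** Only continuity is extracted from smoothness; the explicit constant keeps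
    bounds for finitely many functions easy to combine. *)
Lemma smooth_in_chart_near_le (V : normedModType R) i (A : set M) (f : M -> V) x0 :
  smooth_in_chart i A f -> dom i x0 -> A x0 ->
  \forall x \near x0, `|f x| <= `|f x0| + 1.
Proof.
move=> /(_ 0%N)[fC _] dx0 Ax0.
have y0A : (phi i @` (dom i `&` A)) (phi i x0) by exists x0.
have /cvgrPdistC_le/(_ 1 ltr01) := fC _ y0A.
rewrite /= phiK// => H.
have := @phi_continuous _ _ _ S i x0 dx0 _ H.
have dN : nbhs x0 (dom i) by apply: open_nbhs_nbhs; split => //; exact: dom_open.
apply: filterS2 dN => x dx /=; rewrite phiK// => fx.
by rewrite -[f x](subrK (f x0)) addrC (le_trans (ler_normD _ _))// lerD2l.
Qed.

Lemma near_phi i x0 (P : set 'rV[R]_n) : dom i x0 -> nbhs (phi i x0) P ->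
  \forall x \near x0, P (phi i x).
Proof. by move=> dx0; exact: (@phi_continuous _ _ _ S i x0 dx0). Qed.

Lemma near_dom i x0 : dom i x0 -> \forall x \near x0, dom i x.
Proof. by move=> dx; apply: open_nbhs_nbhs; split => //; exact: dom_open. Qed.

Lemma det_le (G : 'M[R]_n) (B : R) : (forall s t, `|G s t| <= B) ->
  \det G <= #|'S_n|%:R * B ^+ n.
Proof.
move=> GB; apply: le_trans (ler_norm _) _.
apply: le_trans (ler_norm_sum _ _ _) _.
apply: (@le_trans _ _ (\sum_(s : {perm 'I_n}) B ^+ n)); last first.
  by rewrite sumr_const mulr_natl.
apply: ler_sum => s _; rewrite normrM normrX normrN1 expr1n mul1r normr_prod.
rewrite -[X in B ^+ X]card_ord -prodr_const.
by apply: ler_prod => l _; rewrite normr_ge0 GB.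
Qed.

Lemma gram_bounded_near i x0 : dom i x0 ->
  exists B : R, \forall x \near x0, forall s t, `|gram g i x s t| <= B.
Proof.
move=> dx0; exists (\sum_s \sum_t `|gram g i x0 s t| + 1).
apply: filter_forall => s; apply: filter_forall => t.
have := smooth_in_chart_near_le (@gram_smooth _ _ _ _ g i s t) dx0 Logic.I.
apply: filterS => x; move=> H; apply: le_trans H _.
rewrite lerD2r (bigD1 s)//= (bigD1 t)//= -addrA lerDl.
by rewrite addr_ge0// sumr_ge0// => *; exact: sumr_ge0.
Qed.

End LocalBounds.

Lemma borel_open (T : ptopologicalType) (A : set (borel T)) :
  open (A : set T) -> measurable A.
Proof. by move=> oA; exact: sub_sigma_algebra. Qed.

Lemma borel_closed (T : ptopologicalType) (A : set (borel T)) :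
  closed (A : set T) -> measurable A.
Proof.
move=> cA; rewrite -[A]setCK; apply: measurableC; apply: borel_open.
exact: closed_openC.
Qed.

(** Near [x0] the volume has a bounded density with respect to Lebesgue measure
    in the coordinates of a chart, and a small coordinate box has finite Lebesgue
    measure. *)
Lemma volume_locally_finite (R : realType) (n : nat) (M : ptopologicalType)
    (S : smooth_manifold R n M) (g : riemannian_metric S)
    (dv : {measure set (borel M) -> \bar R}) (x0 : M) :
  is_riemannian_volume g dv ->
  exists A : set (borel M), [/\ nbhs x0 (A : set M), measurable A & (dv A < +oo)%E].
Proof.
move=> [leb lebP dvP]; have [i dx0] := dom_cover S x0; pose y0 := phi i x0.
have iy0 : (phi i @` dom i) y0 by exists x0.
have [B HB] := gram_bounded_near g dx0.
have [d d0 Hd] : exists2 d : R, 0 < d & forall z, `|z - y0| <= d ->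
    (phi i @` dom i) z /\ forall s t, `|gram g i (phi_inv i z) s t| <= B.
  have : \forall z \near y0, (phi i @` dom i) z /\
      forall s t, `|gram g i (phi_inv i z) s t| <= B.
    near=> z; split; first by near: z; exact: nbhs_codom.
    near: z; move: HB; rewrite -{1}(phiK dx0) => HB.
    exact: (phi_inv_continuous iy0 HB).
  move=> /nbhs_ballP[d /= d0 H]; exists (d / 2); first by rewrite divr_gt0.
  move=> z zd; apply: H; rewrite -ball_normE /ball_/= distrC.
  by rewrite (le_lt_trans zd)// ltr_pdivrMr// ltr_pMr// ltr1n.
pose Bx : set (borel 'rV[R]_n) := [set z : 'rV[R]_n | `|z - y0| <= d].
pose K : set (borel M) := phi_inv i @` Bx.
have cK : closed (K : set M).
  by apply: closed_image_ball => z /Hd[].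
have mK : measurable K by exact: borel_closed.
have Kdom : K `<=` dom i by move=> _ [z /Hd[iz _] <-]; have [] := codomP iz.
exists K; split => //.
  have yB : nbhs y0 (Bx : set 'rV[R]_n).
    apply/nbhs_ballP; exists d => // z; rewrite -ball_normE /ball_/= distrC.
    exact: ltW.
  apply: filterS2 (near_dom dx0) (near_phi dx0 yB) => x dx xB.
  by exists (phi i x) => //; rewrite phiK.
rewrite (dvP i K mK Kdom).
have -> : phi i @` K = Bx.
  apply/seteqP; split => [_ [_ [z zB <-] <-]|z zB].
    by have [/codomP[_ ->] _] := Hd _ zB.
  by have [/codomP[_ zE] _] := Hd _ zB; exists (phi_inv i z) => //; exists z.
pose a := y0 - const_mx d; pose b := y0 + const_mx d.
have BxE : Bx = [set y : 'rV[R]_n | forall s, a 0 s <= y 0 s <= b 0 s].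
  apply/seteqP; split => z /= zB.
    move=> s; have := le_trans (coord_ler_norm (z - y0) 0 s) zB.
    by rewrite !mxE ler_norml => /andP[? ?]; apply/andP; split; lra.
  apply: mx_norm_ler; first exact: ltW.
  move=> r s; rewrite (ord1 r); have := zB s.
  by rewrite !mxE ler_norml => /andP[? ?]; apply/andP; split; lra.
have lebB : (leb Bx < +oo)%E.
  rewrite BxE lebP ?ltry// => s; rewrite !mxE; lra.
have mB : measurable Bx.
  by apply: borel_closed; exact: closed_norm_le.
pose C := #|'S_n|%:R * B ^+ n.
apply: (@le_lt_trans _ _ ((Num.sqrt C)%:E * leb Bx)%E).
  apply: ge0_integral_le_cst => //.
  move=> z /Hd[_ zB]; rewrite lee_fin ler_wsqrtr//; exact: det_le.
by rewrite lte_mul_pinfty// lee_fin sqrtr_ge0.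
Unshelve. all: by end_near. Qed.

(** * Local boundedness of the norm of a form *)

Lemma sqr_le_sqr_norm (R : realType) (a b : R) : `|a| <= b -> a ^+ 2 <= b ^+ 2.
Proof.
move=> ab; rewrite -(real_normK (num_real a)) lerXn2r ?nnegrE//.
exact: le_trans ab.
Qed.

Section FormBounds.
Context (R : realType) (n : nat) (M : topologicalType) (S : smooth_manifold R n M).
Context (g : riemannian_metric S).
Context (k : nat) (E : vector_bundle S k) (h : fiber_metric E).
Context (p : nat) (w : bundle_form E p).
Implicit Types i j : chart S.

Section Fiber.
Variable x : M.
Implicit Types u v : fiber E x.
Let q u := inner h u u.

Lemma inner0l v : inner h 0 v = 0.
Proof.
have := @inner_linear _ _ _ _ _ _ h x 1 0 0 v; rewrite scaler0 addr0 mul1r => H.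
by apply: (addrI (inner h 0 v)); rewrite addr0 -H.
Qed.

Lemma innerDl u v v' : inner h (u + v) v' = inner h u v' + inner h v v'.
Proof. by have := @inner_linear _ _ _ _ _ _ h x 1 u v v'; rewrite scale1r mul1r. Qed.

Lemma innerZl (a : R) u v : inner h (a *: u) v = a * inner h u v.
Proof. by have := @inner_linear _ _ _ _ _ _ h x a u 0 v; rewrite addr0 inner0l addr0. Qed.

Lemma inner_ge0 u : 0 <= q u.
Proof.
by have [->|u0] := eqVneq u 0; [rewrite /q inner0l|apply/ltW/inner_posdef].
Qed.

Lemma inner_suml (I : finType) (F : I -> fiber E x) v :
  inner h (\sum_s F s) v = \sum_s inner h (F s) v.
Proof.
by apply: (big_morph (fun u => inner h u v)) => [u u'|]; [exact: innerDl|exact: inner0l].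
Qed.

Lemma normsqZ (a : R) u : q (a *: u) = a ^+ 2 * q u.
Proof. by rewrite /q innerZl inner_sym innerZl mulrA expr2. Qed.

(** Expand the nonnegative square of [u - v]. *)
Lemma inner_le_mean u v : inner h u v <= (q u + q v) / 2.
Proof.
have := inner_ge0 (u + (-1) *: v).
rewrite /q innerDl (inner_sym h u) (inner_sym h ((-1) *: v)) !innerDl !innerZl.
rewrite (inner_sym h u (_ *: _)) (inner_sym h v (_ *: _)) !innerZl (inner_sym h v u).
lra.
Qed.

(** Bounding each cross term by a mean of two squares replaces the
    Cauchy-Schwarz inequality. *)
Lemma normsq_sum_le (I : finType) (F : I -> fiber E x) :
  q (\sum_s F s) <= #|I|%:R * \sum_s q (F s).
Proof.
rewrite {1}/q inner_suml.
apply: (@le_trans _ _ (\sum_(s : I) \sum_(t : I) (q (F s) + q (F t)) / 2)).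
  apply: ler_sum => s _; rewrite inner_sym inner_suml.
  by apply: ler_sum => t _; rewrite inner_sym; exact: inner_le_mean.
set X := \sum_s q (F s).
have E1 s : \sum_t (q (F s) + q (F t)) / 2 = (#|I|%:R * q (F s) + X) / 2.
  by rewrite -mulr_suml big_split/= sumr_const mulr_natl.
rewrite (eq_bigr _ (fun s _ => E1 s)) -mulr_suml big_split/= -mulr_sumr.
rewrite sumr_const -/X mulr_natl; lra.
Qed.

Lemma normsq_triv_le (a : triv_index E) (W H : R) u : triv_dom a x ->
  (forall s, `|triv a x u 0 s| <= W) ->
  (forall s, q (triv_inv a x (delta_mx 0 s)) <= H) ->
  q u <= k%:R * (k%:R * (W ^+ 2 * H)).
Proof.
move=> ax uW eH.
have uE : u = \sum_s triv a x u 0 s *: triv_inv a x (delta_mx 0 s).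
  apply: (can_inj (trivK ax)); rewrite linear_sum/=.
  rewrite [LHS]row_sum_delta; apply: eq_bigr => s _.
  by rewrite linearZ/= (triv_invK ax).
rewrite {1}uE; apply: le_trans (normsq_sum_le _) _.
rewrite card_ord ler_wpM2l//.
apply: (@le_trans _ _ (\sum_(s < k) W ^+ 2 * H)); last first.
  by rewrite sumr_const card_ord mulr_natl.
apply: ler_sum => s _; rewrite normsqZ ler_pM ?sqr_ge0 ?inner_ge0//.
exact: sqr_le_sqr_norm.
Qed.

Section Slot.
Variables (i : chart S) (dx : dom i x).

(** Convertible to the update in the axiom of multilinearity; the name lets the
    slot be treated as the argument of a linear map. *)
Definition subst_slot (v : 'I_p -> 'rV[R]_n) (l : 'I_p) (u : 'rV[R]_n) :
  'I_p -> 'rV[R]_n := [eta v with l |-> u].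

Let fs (v : 'I_p -> 'rV[R]_n) (l : 'I_p) (u : 'rV[R]_n) : fiber E x :=
  Defs.form w i x (subst_slot v l u).

Lemma form_slotP (v : 'I_p -> 'rV[R]_n) l (a : R) (u u' : 'rV[R]_n) :
  fs v l (a *: u + u') = a *: fs v l u + fs v l u'.
Proof. exact: form_multilinear. Qed.

Lemma form_slot0 (v : 'I_p -> 'rV[R]_n) l : fs v l 0 = 0.
Proof.
have := form_slotP v l 1 0 0; rewrite !scale1r addr0 => H.
by apply: (addrI (fs v l 0)); rewrite addr0 -H.
Qed.

Lemma form_slot_sum (v : 'I_p -> 'rV[R]_n) l (u : 'rV[R]_n) :
  fs v l u = \sum_s u 0 s *: fs v l (delta_mx 0 s).
Proof.
rewrite {1}[u]row_sum_delta.
rewrite (big_morph (fs v l) (id1 := 0) (op1 := +%R)) => [|a b|]; last 2 first.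
- by rewrite -[a]scale1r form_slotP !scale1r.
- exact: form_slot0.
apply: eq_bigr => s _.
by rewrite -[u 0 s *: delta_mx 0 s]addr0 form_slotP form_slot0 addr0.
Qed.

(** Expand the arguments along the coordinate basis, one slot after another: a
    slot costs the factor [n] of [normsq_sum_le] times the sum of the squares of
    its [n] coefficients, each at most [b]. *)
Lemma form_normsq_le (b Q : R) (v : 'I_p -> 'rV[R]_n) : 0 <= Q -> 0 <= b ->
  (forall I : 'I_p -> 'I_n, q (Defs.form w i x (fun l => delta_mx 0 (I l))) <= Q) ->
  (forall l s, v l 0 s ^+ 2 <= b) ->
  q (Defs.form w i x v) <= (n%:R * (n%:R * b)) ^+ p * Q.
Proof.
move=> Q0 b0 HQ.
pose c := n%:R * (n%:R * b); have c0 : 0 <= c by rewrite !mulr_ge0.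
(* m counts the slots that are still arbitrary; the others hold basis vectors. *)
suff key m : (m <= p)%N -> forall v : 'I_p -> 'rV[R]_n,
    (forall l : 'I_p, (l < m)%N -> forall s, v l 0 s ^+ 2 <= b) ->
    (forall l : 'I_p, (m <= l)%N -> exists s, v l = delta_mx 0 s) ->
    q (Defs.form w i x v) <= c ^+ m * Q.
  by move=> vb; apply: key => // l; rewrite leqNgt ltn_ord.
elim: m => [_ {}v _ vd|m IH mp {}v vb vd].
  have /choice[I HI] : forall l, exists s, v l = delta_mx 0 s by move=> l; exact: vd.
  rewrite expr0 mul1r; have -> : v = fun l => delta_mx 0 (I l) by exact/funext.
  exact: HQ.
pose l := Ordinal mp.
have -> : v = subst_slot v l (v l).
  by apply/funext => l'; rewrite /subst_slot/=; case: eqP => [->|].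
rewrite [Defs.form _ _ _ _]form_slot_sum; apply: le_trans (normsq_sum_le _) _.
rewrite card_ord exprS -!mulrA ler_wpM2l//.
apply: (@le_trans _ _ (\sum_(s < n) b * (c ^+ m * Q))); last first.
  by rewrite sumr_const card_ord -[leLHS]mulr_natl.
apply: ler_sum => s _; rewrite normsqZ ler_pM ?sqr_ge0 ?inner_ge0//.
  exact: vb.
apply: IH; first exact: ltnW.
  move=> l' l'm t; rewrite /subst_slot/=.
  case: eqP => [l'E|_]; first by move: l'm; rewrite l'E /l ltnn.
  by apply: vb; exact: ltnW.
move=> l' ml'; rewrite /subst_slot/=; case: eqP => [_|l'E]; first by exists s.
apply: vd; rewrite ltn_neqAle ml' andbT; apply/eqP => E'.
by apply: l'E; apply/val_inj.
Qed.

End Slot.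

Lemma form_normsq_ge0 : 0 <= form_normsq g h w x.
Proof.
rewrite /form_normsq; case: xgetP => [c _ [i [e [_ _ ->]]]|//].
by apply: sumr_ge0 => I _; exact: inner_ge0.
Qed.

(** The norm is computed in a chart [j] and an orthonormal frame that are not
    under control.  The transition rules of the form and of the metric move the
    computation to the chart [i], where coercivity bounds the squares of the
    coordinates of the frame vectors by [1 / kap]. *)
Lemma form_normsq_frame_le i (kap Q : R) : dom i x -> 0 < kap -> 0 <= Q ->
  (forall u : 'rV[R]_n, kap * `|u| ^+ 2 <= (u *m gram g i x *m u^T) 0 0) ->
  (forall I : 'I_p -> 'I_n, q (Defs.form w i x (fun l => delta_mx 0 (I l))) <= Q) ->
  form_normsq g h w x <=
    #|{ffun 'I_p -> 'I_n}|%:R * ((n%:R * (n%:R * kap^-1)) ^+ p * Q).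
Proof.
move=> dx k0 Q0 Hk HQ; have ki0 : 0 <= kap^-1 by rewrite invr_ge0 ltW.
have B0 : 0 <= (n%:R * (n%:R * kap^-1)) ^+ p * Q.
  by rewrite mulr_ge0// exprn_ge0// !mulr_ge0.
rewrite /form_normsq; case: xgetP => [c _ [j [e [dj eo ->]]]|_]; last by rewrite mulr_ge0.
rewrite -sum1_card natr_sum mulr_suml big_mkcond/=.
apply: ler_sum => I _; case: ifP => _; last by rewrite mul1r.
rewrite mul1r (form_transition w _ dj dx).
apply: form_normsq_le => // l s /=.
pose u := e (I l) *m transition_jacobian j i x.
have u1 : (u *m gram g i x *m u^T) 0 0 = 1.
  have := eo (I l) (I l); rewrite eqxx (gram_transition g dj dx) => H.
  rewrite -[RHS]/(true%:R) -H.
  by rewrite /u trmx_mul !mulmxA.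
apply: (@le_trans _ _ (`|u| ^+ 2)).
  by apply: sqr_le_sqr_norm; exact: coord_ler_norm.
by rewrite -[kap^-1]mulr1 -ler_pdivrMl ?invr_gt0// invrK -u1; exact: Hk.
Qed.

End Fiber.

(** In a chart and a local trivialization, the form and the fiber metric have
    finitely many coefficients, which are continuous, and the Gram matrices are
    uniformly coercive near [x0]. *)
Lemma form_normsq_bounded_near (x0 : M) :
  exists C : R, \forall x \near x0, form_normsq g h w x <= C.
Proof.
have [i dx0] := dom_cover S x0; have [a ax0] := triv_dom_cover E x0.
have iy0 : (phi i @` dom i) (phi i x0) by exists x0.
have [kap kap0 Hkap] := gram_coercive_near g iy0.
pose ff (I : {ffun 'I_p -> 'I_n}) x :=
  triv a x (Defs.form w i x (fun l => delta_mx 0 (I l))).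
pose gg s x : R := inner h (triv_inv a x (delta_mx 0 s)) (triv_inv a x (delta_mx 0 s)).
pose W := \sum_I `|ff I x0| + 1; pose H := \sum_s `|gg s x0| + 1.
pose Q := k%:R * (k%:R * (W ^+ 2 * H)).
have H0 : 0 <= H by rewrite addr_ge0// sumr_ge0.
have W0 : 0 <= W by rewrite addr_ge0// sumr_ge0.
have Q0 : 0 <= Q by rewrite !mulr_ge0.
exists (#|{ffun 'I_p -> 'I_n}|%:R * ((n%:R * (n%:R * kap^-1)) ^+ p * Q)).
near=> x.
have dx : dom i x by near: x; exact: near_dom.
have ax : triv_dom a x.
  by near: x; apply: open_nbhs_nbhs; split => //; exact: triv_dom_open.
apply: (form_normsq_frame_le dx kap0 Q0).
  have : forall u : 'rV[R]_n, kap * `|u| ^+ 2 <=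
      (u *m gram g i (phi_inv i (phi i x)) *m u^T) 0 0.
    by near: x; exact: near_phi Hkap.
  by rewrite phiK.
move=> I; apply: (normsq_triv_le ax) => s.
- have : `|ff (finfun I) x| <= W.
    move: (finfun I); near: x; apply: filter_forall => J.
    have := smooth_in_chart_near_le (@form_smooth _ _ _ _ _ _ _ w i a J) dx0 ax0.
    apply: filterS => x /le_trans; apply.
    by rewrite lerD2r (bigD1 J)//= lerDl sumr_ge0.
  apply: le_trans; apply: le_trans (coord_ler_norm _ 0 s) _.
  rewrite le_eqVlt; apply/orP; left; apply/eqP; congr (`|triv a x (Defs.form w i x _)|).
  by apply/funext => l; rewrite ffunE.
- have : `|gg s x| <= H.
    move: s; near: x; apply: filter_forall => s.
    have := smooth_in_chart_near_le (@inner_smooth _ _ _ _ _ _ h a i s s) dx0 ax0.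
    apply: filterS => x /le_trans; apply.
    by rewrite lerD2r (bigD1 s)//= lerDl sumr_ge0.
  by apply: le_trans; exact: ler_norm.
Unshelve. all: by end_near. Qed.

End FormBounds.

(** * Slowly divergent energy *)

Theorem theorem10p1 (R : realType) (n : nat) (M : ptopologicalType)
    (S : smooth_manifold R n M) (g : riemannian_metric S)
    (g_complete : complete_metric g)
    (dv : {measure set (borel M) -> \bar R})
    (dv_volume : is_riemannian_volume g dv)
    (x0 : M)
    (k : nat) (E : vector_bundle S k) (h : fiber_metric E)
    (p : nat) (w : bundle_form E p)
    (F : R -> R)
    (F_ge0 : forall t : R, 0 <= t -> 0 <= F t)
    (F_incr : forall s t : R, 0 <= s -> s < t -> F s < F t)
    (F_C2 : C2_nonneg F)
    (F0 : F 0 = 0)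
    (psi : R -> R)
    (psi_gt0 : forall r : R, 0 < r -> 0 < psi r)
    (psi_continuous : forall r : R, 0 < r -> {for r, continuous psi})
    (psi_divergent : exists2 rho0 : R, 0 < rho0 &
      (\int[lebesgue_measure]_(r in `[rho0, +oo[) ((r * psi r)^-1)%:E)%E
        = +oo%E)
    (w_slowly_divergent : exists2 l : \bar R, (l < +oo)%E &
      (\int[dv]_(x in geodesic_ball g x0 rho)
         (F (form_normsq g h w x / 2)
            / psi (fine (geodesic_dist g x0 x)))%:E)%E
        @[rho --> +oo] --> l) :
  (forall lambda : R, 0 < lambda ->
     ~ (psi r / r `^ lambda @[r --> +oo] --> +oo)) /\
  (forall lambda : R, 0 < lambda ->
     (exists l : \bar R, (psi r / r `^ lambda)%:E @[r --> +oo] --> l) ->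
     let energy (rho : R) := (\int[dv]_(x in geodesic_ball g x0 rho)
                                (F (form_normsq g h w x / 2))%:E)%E in
     (forall rho : R, (energy rho < +oo)%E) /\
     (fun rho : R => fine (energy rho) : R^o)
       =o_+oo (fun rho : R => rho `^ lambda : R^o)).
Proof.
have part1 := not_cvgy_div_powR psi_gt0 psi_continuous psi_divergent.
split => // lambda lambda0 [l psil] energy.
(* By the first part the limit is not +oo, so it lies below a real number D. *)
have [D psiD] : exists D : R, \forall r \near +oo, psi r <= D * r `^ lambda.
  have [D lD] : exists D : R, (l < D%:E)%E.
    case: l psil => [r _|psil|_]; last by exists 0; rewrite ltNyr.
      by exists (r + 1); rewrite lte_fin ltrDl.
    by have /cvgeryP /(part1 _ lambda0) := psil.
  have H := psil _ (open_ereal_lt' lD).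
  exists D; near=> r; rewrite -ler_pdivrMr; last first.
    by apply: powR_gt0; near: r; exact: (nbhs_pinfty_gt (num_real _)).
  by rewrite -lee_fin; apply: ltW; near: r; exact: H.
have [l' l'oo Phi_cvg] := w_slowly_divergent.
have F_le s t : 0 <= s -> s <= t -> F s <= F t.
  by move=> s0; rewrite le_eqVlt => /predU1P[->//|st]; apply/ltW/F_incr.
have [A [x0A mA dvA]] := volume_locally_finite x0 dv_volume.
have [C HC] := form_normsq_bounded_near g h w x0.
have [eps eps0 epsU] := geodesic_ball_sub_nbhs g (filterI x0A HC).
have mB rho : measurable (geodesic_ball g x0 rho : set (borel M)).
  by apply: borel_open; exact: open_geodesic_ball.
have dist0 := geodesic_dist_ge0 g x0.
have f0 x : 0 <= F (form_normsq g h w x / 2).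
  by apply: F_ge0; rewrite divr_ge0// form_normsq_ge0.
have fC x : geodesic_ball g x0 eps x ->
    F (form_normsq g h w x / 2) <= F (C / 2).
  move=> /epsU[_ /= wC]; apply: F_le; first by rewrite divr_ge0// form_normsq_ge0.
  by rewrite ler_wpM2r.
have C0 : 0 <= F (C / 2).
  have wC : form_normsq g h w x0 <= C by exact: nbhs_singleton HC.
  by apply: F_ge0; rewrite divr_ge0// (le_trans _ wC)// form_normsq_ge0.
have muB : (dv (geodesic_ball g x0 eps) < +oo)%E.
  by apply: le_lt_trans dvA; apply: le_measure; rewrite ?inE// => x /epsU[].
split=> [rho|].
  exact: (energy_lty (mu := dv) (dist := geodesic_dist g x0) dist0 mB f0
    psi_gt0 psi_continuous C0 eps0 muB fC l'oo Phi_cvg).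
have H := energy_little_o (mu := dv) (dist := geodesic_dist g x0) dist0 mB f0
  psi_gt0 psi_continuous C0 eps0 muB fC l'oo
  Phi_cvg lambda0 psiD.
apply/eqoP => e e0; have := H e e0; apply: filterS => rho Hrho.
rewrite ger0_norm; last by apply: fine_ge0; apply: integral_ge0 => x _; rewrite lee_fin.
by rewrite [X in _ * X]ger0_norm ?powR_ge0.
Unshelve. all: by end_near. Qed.
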